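(* Let $G$ be a countable infinite discrete group and let $T$ be the $(C,F)$-action of $G$ associated with a sequence $(C_n,F_{n-1})_{n\ge1}$ satisfying (I)–(III) and $$\lim_{m\to\infty}\frac{\#((gF_nC_{n+1}C_{n+2}\cdots C_m)\cap F_m)}{\#F_n\,\#C_{n+1}\cdots\#C_m}=1\quad\text{for each }g\in G\text{ and }n>0.$$ Then $T$ (with its $(C,F)$-measure) is measure theoretically isomorphic to the $(C,F)$-action $S$ of $G$ associated with a sequence $(C'_n,F'_{n-1})_{n\ge1}$ satisfying (I)–(III) and the condition: for each $g\in G$ and $n>0$ there is $m>n$ such that $gF'_nC'_{n+1}C'_{n+2}\cdots C'_m\subset F'_m$. Moreover, the sequence $(F'_n)_{n\ge0}$ is a subsequence of $(F_n)_{n\ge0}$. In particular, if $G=\mathbb Z$ and $T$ is of rank one then $S$ is also of rank one.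
   Context: **$(C,F)$-construction.** $(F_n)_{n\ge0}$, $(C_n)_{n\ge1}$ are finite subsets of $G$ with: (I) $F_0=\{1\}$, $\#C_n>1$; (II) $F_nC_{n+1}\subset F_{n+1}$; (III) $F_nc\cap F_nc'=\emptyset$ for distinct $c,c'\in C_{n+1}$. $X_n=F_n\times C_{n+1}\times C_{n+2}\times\cdots$ (product topology) is embedded into $X_{n+1}$ by $(f_n,c_{n+1},c_{n+2},\dots)\mapsto(f_nc_{n+1},c_{n+2},\dots)$; $X$ is the topological inductive limit of $(X_n)$. For $A\subset F_n$, $[A]_n=\{(f_n,c_{n+1},\dots)\in X_n:f_n\in A\}$. The $(C,F)$-measure is the Radon measure on $X$ with $\mu([A]_n)=\#A/(\#C_1\cdots\#C_n)$; it is considered up to scaling, and isomorphism of $(C,F)$-systems is understood as an a.e. bijective equivariant Borel map carrying one measure to a positive multiple of the other. The $(C,F)$-action: for $x=(f_n,c_{n+1},\dots)\in X_n$ with $gf_n\in F_n$, $T_gx=(gf_n,c_{n+1},\dots)$; under the displayed limit condition each $T_g$ is defined $\mu$-a.e. and $T$ preserves $\mu$. **Rank one** (for $\mathbb Z$-actions): there are finite-measure sets $B_n$ and sets $F_n=\{0,1,\dots,\#F_n-1\}$ such that for each $n$ the sets $T_gB_n$, $g\in F_n$, are pairwise disjoint, and $\lim_n\inf_{F\subset F_n}\mu(B\triangle\bigsqcup_{g\in F}T_gB_n)=0$ for each measurable $B$ with $\mu(B)<\infty$. *)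

(* Defs.v *)
From HB Require Import structures.
From mathcomp Require Import all_boot all_order all_algebra.
From mathcomp Require Import generic_quotient finmap.
From mathcomp Require Import all_classical all_reals all_analysis.

Set Implicit Arguments.
Unset Strict Implicit.
Unset Printing Implicit Defensive.

Import Order.TTheory GRing.Theory Num.Theory.
Import numFieldNormedType.Exports.

Local Open Scope classical_set_scope.
Local Open Scope fset_scope.
Local Open Scope group_scope.

Section FinitePointwiseProducts.
Variable G : groupType.
Implicit Types (g : G) (A B : {fset G}).

Definition fset_mul A B : {fset G} := [fset a * b | a in A, b in B].
Definition fset_lmul g A : {fset G} := [fset g * a | a in A].
Definition fset_rmul A g : {fset G} := [fset a * g | a in A].

End FinitePointwiseProducts.

(* [CF_C T 0] is a dummy value: only C_1, C_2, ... are used. *)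
Record CFseq (G : groupType) := MkCFseq {
  CF_F : nat -> {fset G};
  CF_C : nat -> {fset G};
  CF_F0 : CF_F 0 = [fset 1];
  CF_C_gt1 : forall n, (1 < #|` CF_C n.+1 |)%N;
  CF_FC_sub : forall n, fset_mul (CF_F n) (CF_C n.+1) `<=` CF_F n.+1;
  CF_FC_disj : forall n c c', c \in CF_C n.+1 -> c' \in CF_C n.+1 -> c != c' ->
    [disjoint fset_rmul (CF_F n) c & fset_rmul (CF_F n) c']
}.

Section CFspace.
Variables (G : groupType) (T : CFseq G).
Local Notation F := (CF_F T).
Local Notation C := (CF_C T).

(* The point (f_n, c_{n+1}, c_{n+2}, ...) of X_n is the pair (f, c) with
   f = f_n and c i = c_{n+1+i}. As F_n and all the C_i are discrete, the topology
   induced from G * G^nat is the product topology of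
   F_n * C_{n+1} * C_{n+2} * ... *)
Definition CF_Xn_set (n : nat) :
    set (discrete_topology G * {ptws nat -> discrete_topology G}) :=
  [set x | x.1 \in F n /\ forall i, x.2 i \in C (n + i).+1].

Definition CF_Xn (n : nat) : topologicalType := set_type (CF_Xn_set n).

Lemma CF_embed_subproof n (x : CF_Xn n) :
  ((\val x).1 * (\val x).2 0%N, fun i => (\val x).2 i.+1)
    \in CF_Xn_set n.+1.
Proof.
apply/mem_set; have /set_mem [xF xC] := valP x; split => /=.
  apply: (fsubsetP (CF_FC_sub T n)); apply/imfset2P => /=.
  exists (\val x).1; first exact: xF.
  by exists ((\val x).2 0%N) => //; have := xC 0%N; rewrite addn0.
by move=> i; have := xC i.+1; rewrite addnS addSn.
Qed.

Definition CF_embed n (x : CF_Xn n) : CF_Xn n.+1 := SigSub (CF_embed_subproof x).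

(* The inductive limit is the quotient of the disjoint union of the X_n by the
   relation identifying two points that become equal in some X_m. *)
Definition CF_sum : topologicalType := {n : nat & CF_Xn n}.

Definition CF_shift (u : CF_sum) : CF_sum :=
  existT (fun n => CF_Xn n) (projT1 u).+1 (CF_embed (projT2 u)).

Definition CF_limrel (u v : CF_sum) : bool :=
  `[< exists k l, iter k CF_shift u = iter l CF_shift v >].

Lemma CF_limrel_refl : reflexive CF_limrel.
Proof. by move=> u; apply/asboolP; exists 0%N, 0%N. Qed.

Lemma CF_limrel_sym : symmetric CF_limrel.
Proof. by move=> u v; apply/asboolP/asboolP => -[k [l kl]]; exists l, k. Qed.

Lemma CF_limrel_trans : transitive CF_limrel.
Proof.
move=> v u w /asboolP [k [l kl]] /asboolP [k' [l' kl']]; apply/asboolP.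
exists (k' + k)%N, (l + l')%N.
by rewrite iterD kl -iterD addnC iterD kl' -iterD.
Qed.

Definition CF_limequiv :=
  EquivRel CF_limrel CF_limrel_refl CF_limrel_sym CF_limrel_trans.

Definition CF_space : Type := quotient_topology {eq_quot CF_limequiv}%qT.

HB.instance Definition _ := Topological.on CF_space.
HB.instance Definition _ := Quotient.on CF_space.

Definition CF_pt (n : nat) (x : CF_Xn n) : CF_space :=
  (\pi_CF_space (existT (fun n => CF_Xn n) n x))%qT.

Lemma CF_base_subproof :
  (1, fun i => nth 1 (CF_C T i.+1) 0) \in CF_Xn_set 0.
Proof.
apply/mem_set; split => /=; first by rewrite CF_F0 inE.
by move=> i; rewrite add0n mem_nth // (ltn_trans _ (CF_C_gt1 T i)).
Qed.

HB.instance Definition _ := isPointed.Build CF_space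
  (CF_pt (SigSub CF_base_subproof : CF_Xn 0)).

Definition CF_borel := g_sigma_algebraType (@open CF_space).

HB.instance Definition _ := Measurable.on CF_borel.

Definition CF_cyl (n : nat) (A : {fset G}) : set CF_space :=
  [set CF_pt x | x in [set x : CF_Xn n | (\val x).1 \in A]].

(* The partial transformation T_g is given by its graph:
   [CF_act g p q] reads "T_g p is defined and equal to q". *)
Definition CF_act (g : G) (p q : CF_space) : Prop :=
  exists n (x y : CF_Xn n),
    [/\ p = CF_pt x, q = CF_pt y,
        (\val y).1 = g * (\val x).1 & (\val y).2 = (\val x).2].

Definition CF_prodC (n m : nat) : {fset G} :=
  \big[@fset_mul G/[fset 1]]_(n.+1 <= i < m.+1) C i.

Definition CF_asymp_invariant (R : realType) : Prop :=
  forall (g : G) (n : nat), (0 < n)%N ->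
    (fun m : nat =>
       (#|` fset_lmul g (fset_mul (F n) (CF_prodC n m)) `&` F m |%:R /
        (#|` F n | * \prod_(n.+1 <= i < m.+1) #|` C i |)%:R : R)%R)
    @ \oo --> (1%R : R).

Definition CF_eventually_invariant : Prop :=
  forall (g : G) (n : nat), (0 < n)%N -> exists m, (n < m)%N /\
    fset_lmul g (fset_mul (F n) (CF_prodC n m)) `<=` F m.

End CFspace.

Local Open Scope ring_scope.

Section CFmeasure.
Variables (R : realType) (G : groupType) (T : CFseq G).
Variable mu : {measure set (CF_borel T) -> \bar R}.
Local Open Scope ereal_scope.

Definition CF_radon : Prop :=
  (forall K : set (CF_space T), compact K -> mu K < +oo) /\
  (forall A : set (CF_borel T), measurable A ->
     mu A = ereal_sup
       [set mu K | K in [set K : set (CF_space T) | compact K /\ (K `<=` A)%classic]]).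

Definition CF_measure : Prop :=
  CF_radon /\
  forall (n : nat) (A : {fset G}), (A `<=` CF_F T n)%fset ->
    mu (CF_cyl n A) =
    (#|` A |%:R / (\prod_(1 <= i < n.+1) #|` CF_C T i |)%:R)%R%:E.

End CFmeasure.

(* Partial transformations are given by their graphs, as in [CF_act]. *)
Definition ae_isomorphic (R : realType) (H : Type) (d d' : measure_display)
    (X : measurableType d) (Y : measurableType d')
    (mu : {measure set X -> \bar R}) (nu : {measure set Y -> \bar R})
    (T : H -> X -> X -> Prop) (S : H -> Y -> Y -> Prop) : Prop :=
  exists phi : X -> Y,
    [/\ measurable_fun setT phi,
        exists N M, [/\ measurable N, mu N = 0%E, measurable M, nu M = 0%E
                      & set_bij (~` N) (~` M) phi],
        forall h, {ae mu, forall x, exists2 y, T h x y & S h (phi x) (phi y)}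
      & exists2 r : R, 0 < r &
          forall A, measurable A -> mu (phi @^-1` A) = (r%:E * nu A)%E].

Definition graph_image (X : Type) (T : X -> X -> Prop) (B : set X) : set X :=
  [set y | exists2 x, B x & T x y].

(* [h n] is the cardinality of the set F_n = {0, ..., h n - 1}. *)
Definition rank_one (R : realType) (d : measure_display) (X : measurableType d)
    (mu : {measure set X -> \bar R}) (T : int -> X -> X -> Prop) : Prop :=
  exists (B : nat -> set X) (h : nat -> nat),
    [/\ forall n, measurable (B n) /\ (mu (B n) < +oo)%E,
        forall n, trivIset `I_(h n) (fun i => graph_image (T i%:Z) (B n))
      & forall A, measurable A -> (mu A < +oo)%E ->
          (fun n => ereal_inf
             [set mu (A `+` \bigcup_(i in I) graph_image (T i%:Z) (B n))
               | I in [set I : set nat | (I `<=` `I_(h n))%classic]])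
          @ \oo --> 0%E].

(* Main.v *)
Require Import Defs.
From HB Require Import structures.
From mathcomp Require Import all_boot all_order all_algebra.
From mathcomp Require Import generic_quotient finmap.
From mathcomp Require Import all_classical all_reals all_analysis.
From mathcomp Require Import zify ring lra.

Set Implicit Arguments.
Unset Strict Implicit.
Unset Printing Implicit Defensive.

Import Order.TTheory GRing.Theory Num.Theory.
Import numFieldNormedType.Exports.

Local Open Scope classical_set_scope.
Local Open Scope ring_scope.

(* With d_j the proportion of c in C_{n+1} ... C_m such that g F_n c is not
   contained in F_m for some g among the first j elements of G, the hypothesis
   makes d_j as small as desired when n is fixed and m is large. Choose levels
   0 = k 0 < k 1 < ... along which d_j <= 2^-(j+2), put F'_j = F_{k j}, and let
   C'_{j+1} be C_{k j + 1} ... C_{k (j + 1)} without the exceptional c. Then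
   g F'_j C'_{j+1} lies in F'_{j+1} for all large j, for every g in G.

   The space X' of the new sequence embeds continuously and equivariantly into
   X. By a Borel-Cantelli type estimate almost every point of X eventually has
   all its coordinates in the sets C'_j, so the image is conull; it is invariant,
   and mu restricts to r times the (C,F)-measure of X', where r > 0 is the limit
   of #(C'_1 x ... x C'_m) / #(C_1 x ... x C_{k m}). Inner regularity passes to
   X' because the image of X' is the increasing union of the compact images of
   the F'_n x C'_{n+1} x C'_{n+2} x ..., on each of which the embedding is a
   homeomorphism. A rank-one tower in X restricts to a rank-one tower in X'. *)

(** * Products of finite subsets of a group *)

Section FsetMul.
Variable G : groupType.
Implicit Types A B D : {fset G}.
Local Open Scope fset_scope.
Local Open Scope group_scope.

Lemma fset_mulP A B x :
  reflect (exists a b, [/\ a \in A, b \in B & x = a * b]) (x \in fset_mul A B).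
Proof.
apply: (iffP (imfset2P _ _ _ _ _)) => [[a aA [b bB ->]]|[a [b [aA bB ->]]]].
  by exists a, b.
by exists a => //; exists b.
Qed.

Lemma mem_fset_mul A B a b : a \in A -> b \in B -> a * b \in fset_mul A B.
Proof. by move=> aA bB; apply/fset_mulP; exists a, b. Qed.

Lemma fset_mulA : associative (@fset_mul G).
Proof.
move=> A B D; apply/fsetP => x; apply/fset_mulP/fset_mulP.
  move=> [a [_ [aA /fset_mulP [b [d [bB dD ->]]] ->]]].
  by exists (a * b), d; rewrite mulgA mem_fset_mul.
move=> [_ [d [/fset_mulP [a [b [aA bB ->]]] dD ->]]].
by exists a, (b * d); rewrite mulgA mem_fset_mul.
Qed.

Lemma fset_mul1s : left_id [fset 1] (@fset_mul G).
Proof.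
move=> A; apply/fsetP => x; apply/fset_mulP/idP => [[_ [b [/fset1P -> bA ->]]]|xA].
  by rewrite mul1g.
by exists 1, x; rewrite inE mul1g.
Qed.

Lemma fset_muls1 : right_id [fset 1] (@fset_mul G).
Proof.
move=> A; apply/fsetP => x; apply/fset_mulP/idP => [[a [_ [aA /fset1P -> ->]]]|xA].
  by rewrite mulg1.
by exists x, 1; rewrite inE mulg1.
Qed.

(** Makes the big-operator splitting lemmas available for [CF_prodC]. The law is not commutative, so
    factors are only split off in order. *)
HB.instance Definition _ :=
  Monoid.isLaw.Build {fset G} [fset 1] (@fset_mul G) fset_mulA fset_mul1s fset_muls1.

Lemma card_fset_mul A B :
  (forall a b a' b', a \in A -> b \in B -> a' \in A -> b' \in B ->
     a * b = a' * b' -> a = a' /\ b = b') ->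
  #|` fset_mul A B| = (#|` A| * #|` B|)%N.
Proof.
move=> inj; have /perm_size : perm_eq (fset_mul A B) [seq a * b | a <- A, b <- B].
  apply: enum_imfset2 => -[a b] [a' b'] /andP [/= aA bB] /andP [/= a'A b'B] /inj.
  by case=> // -> ->.
by rewrite size_allpairs.
Qed.

End FsetMul.

(** * Unique factorization in $F_nC_{n+1}\cdots C_m$ and cardinalities *)

Section Products.
Variables (G : groupType) (T : CFseq G).
Local Notation F := (CF_F T).
Local Notation C := (CF_C T).
Local Notation P := (CF_prodC T).
Local Open Scope fset_scope.
Local Open Scope group_scope.

Lemma prodCnn n : P n n = [fset 1].
Proof. by rewrite /CF_prodC big_geq. Qed.

Lemma prodC_recr n m : (n <= m)%N -> P n m.+1 = fset_mul (P n m) (C m.+1).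
Proof. by move=> nm; rewrite /CF_prodC big_nat_recr. Qed.

Lemma prodC_cat n m p : (n <= m)%N -> (m <= p)%N ->
  P n p = fset_mul (P n m) (P m p).
Proof. by move=> nm mp; rewrite /CF_prodC (@big_cat_nat _ _ _ m.+1). Qed.

Lemma prodC1 n : P n n.+1 = C n.+1.
Proof. by rewrite prodC_recr// prodCnn fset_mul1s. Qed.

(** Condition (III) in multiplicative form: a common value would lie in two translates $F_nc$,
    $F_nc'$, which are disjoint unless $c=c'$. *)
Lemma F_C_inj n f f' c c' : f \in F n -> f' \in F n -> c \in C n.+1 ->
  c' \in C n.+1 -> f * c = f' * c' -> f = f' /\ c = c'.
Proof.
move=> fF f'F cC c'C e; have [cc'|cc'] := eqVneq c c'.
  by subst c'; split=> //; exact: mulIg e.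
have /fdisjointP/(_ (f * c)) := CF_FC_disj cC c'C cc'.
have h x d : x \in F n -> x * d \in fset_rmul (F n) d.
  by move=> xF; exact: (in_imfset _ ( *%g^~ d)).
by rewrite h// e h// => /(_ isT).
Qed.

Lemma F_prodC n m f c : (n <= m)%N -> f \in F n -> c \in P n m -> f * c \in F m.
Proof.
elim: m c => [|m IH] c nm fF; first by case: n nm fF => // _ fF; rewrite prodCnn => /fset1P ->; rewrite mulg1.
move: nm; rewrite leq_eqVlt => /predU1P [e|].
  by subst n; rewrite prodCnn => /fset1P ->; rewrite mulg1.
rewrite ltnS => nm; rewrite prodC_recr// => /fset_mulP [d [e [dP eC ->]]].
rewrite mulgA; apply: (fsubsetP (CF_FC_sub T m)).
by apply: mem_fset_mul => //; exact: IH.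
Qed.

(** Induction on [m]: the last factor is peeled off with [F_C_inj], because the remaining product
    lies in $F_m$. *)
Lemma F_prodC_inj n m f f' c c' : (n <= m)%N -> f \in F n -> f' \in F n ->
  c \in P n m -> c' \in P n m -> f * c = f' * c' -> f = f' /\ c = c'.
Proof.
elim: m c c' => [|m IH] c c' nm fF f'F.
  case: n nm fF f'F => // _ fF f'F; rewrite prodCnn => /fset1P -> /fset1P ->.
  by rewrite !mulg1.
move: nm; rewrite leq_eqVlt => /predU1P [e|].
  by subst n; rewrite prodCnn => /fset1P -> /fset1P ->; rewrite !mulg1.
rewrite ltnS => nm; rewrite prodC_recr//.
move=> /fset_mulP [d [e [dP eC ->]]] /fset_mulP [d' [e' [d'P e'C ->]]].
rewrite !mulgA => de.
have [fd <-] := F_C_inj (F_prodC nm fF dP) (F_prodC nm f'F d'P) eC e'C de.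
by have [-> ->] := IH _ _ nm fF f'F dP d'P fd.
Qed.

Lemma C_neq0 n : exists c, c \in C n.+1.
Proof.
have /fset0Pn [c cC] : C n.+1 != fset0 by rewrite -cardfs_gt0 (ltn_trans _ (CF_C_gt1 T n)).
by exists c.
Qed.

Lemma F_neq0 n : exists f, f \in F n.
Proof.
elim: n => [|n [f fF]]; first by exists 1; rewrite CF_F0 inE.
have [c cC] := C_neq0 n; exists (f * c).
exact/(fsubsetP (CF_FC_sub T n))/mem_fset_mul.
Qed.

Lemma card_mul_prodC n m A : (n <= m)%N -> A `<=` F n ->
  #|` fset_mul A (P n m)| = (#|` A| * #|` P n m|)%N.
Proof.
move=> nm /fsubsetP AF; apply: card_fset_mul => a b a' b' aA bB a'A b'B.
by apply: F_prodC_inj nm _ _ bB b'B; exact: AF.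
Qed.

Lemma card_prodC n m : (n <= m)%N ->
  #|` P n m| = (\prod_(n.+1 <= i < m.+1) #|` C i|)%N.
Proof.
elim: m => [|m IH]; first by case: n => // _; rewrite prodCnn cardfs1 big_geq.
rewrite leq_eqVlt => /predU1P [->|]; first by rewrite prodCnn cardfs1 big_geq.
rewrite ltnS => nm; rewrite big_nat_recr//= -IH// prodC_recr//.
have [f fF] := F_neq0 n.
apply: card_fset_mul => a b a' b' aP bC a'P b'C e.
have : f * (a * b) = f * (a' * b') by rewrite e.
rewrite !mulgA => ab.
by have [/mulgI -> ->] := F_C_inj (F_prodC nm fF aP) (F_prodC nm fF a'P) bC b'C ab.
Qed.

Lemma card_C_gt0 n : (0 < #|` C n.+1|)%N.
Proof. exact: ltn_trans (CF_C_gt1 T n). Qed.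

Lemma prod_card_C_gt0 n m : (0 < \prod_(n.+1 <= i < m.+1) #|` C i|)%N.
Proof.
by rewrite big_add1; apply: prodn_gt0 => i; exact: card_C_gt0.
Qed.

End Products.

(** * Points of the inductive limit described by their coordinates at each level *)

Section Heads.
Variables (G : groupType) (T : CFseq G).
Local Notation F := (CF_F T).
Local Notation C := (CF_C T).
Local Notation P := (CF_prodC T).
Local Notation X := (CF_space T).
Local Open Scope fset_scope.
Local Open Scope group_scope.

Lemma CF_Xn_inj n (x y : CF_Xn T n) :
  (\val x).1 = (\val y).1 -> (\val x).2 =1 (\val y).2 -> x = y.
Proof.
move=> e1 e2; apply: val_inj.
by case: (\val x) (\val y) e1 e2 => a b [c d] /= -> /funext ->.
Qed.

Lemma CF_Xn_F n (x : CF_Xn T n) : (\val x).1 \in F n.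
Proof. by have /set_mem [] := valP x. Qed.

Lemma CF_Xn_C n (x : CF_Xn T n) i : (\val x).2 i \in C (n + i).+1.
Proof. by have /set_mem [] := valP x. Qed.

Lemma CF_Xn_mk n f (c : nat -> G) : f \in F n -> (forall i, c i \in C (n + i).+1) ->
  exists2 x : CF_Xn T n, (\val x).1 = f & (\val x).2 = c.
Proof.
move=> fF cC; have xP : (f, c) \in CF_Xn_set T n by exact/mem_set.
by exists (SigSub xP).
Qed.

(** The embedding of $X_n$ into $X_{n+1}$ loses nothing, since $f_n$ and $c_{n+1}$ are recovered
    from $f_nc_{n+1}$ by unique factorization. *)
Lemma CF_shift_inj : injective (@CF_shift G T).
Proof.
move=> [n x] [m y] e; have nm : n = m by case: (congr1 (@projT1 _ _) e).
subst m; congr existT; move: e => /eqP; rewrite eq_Tagged /= => /eqP.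
move=> /(congr1 \val) /= [e1 e2].
have e3 i : (\val x).2 i.+1 = (\val y).2 i.+1 by exact: (congr1 (@^~ i) e2).
have := @CF_Xn_C _ x 0%N; have := @CF_Xn_C _ y 0%N; rewrite addn0 => yC xC.
have [e4 e5] := F_C_inj (CF_Xn_F x) (CF_Xn_F y) xC yC e1.
by apply: CF_Xn_inj => // -[|i].
Qed.

Lemma CF_pt_eqP n m (x : CF_Xn T n) (y : CF_Xn T m) : CF_pt x = CF_pt y <->
  exists k l, iter k (@CF_shift G T) (existT _ n x) = iter l (@CF_shift G T) (existT _ m y).
Proof.
rewrite /CF_pt; split => [/eqmodP/asboolP //|h].
by apply/eqmodP/asboolP.
Qed.

Lemma projT1_iter_shift k u :
  projT1 (iter k (@CF_shift G T) u) = (k + projT1 u)%N.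
Proof. by elim: k => //= k ->. Qed.

Lemma CF_pt_inj n : injective (@CF_pt G T n).
Proof.
move=> x y /CF_pt_eqP [k [l e]].
have := congr1 (@projT1 _ _) e; rewrite !projT1_iter_shift /= => /addIn kl.
subst l; elim: k e => [/eqP|k IH /CF_shift_inj //].
by rewrite eq_Tagged /= => /eqP.
Qed.

Lemma CF_pt_embed n (x : CF_Xn T n) : CF_pt (CF_embed x) = CF_pt x.
Proof. by apply/CF_pt_eqP; exists 0%N, 1%N. Qed.

(** The working description of a point: [p] lies in $X_n$ and its $F_n$-coordinate is [f]. It is a
    relation because [p] may fail to lie in $X_n$ for small [n]. Arguments with heads avoid both the
    quotient and the types depending on [n]. *)
Definition CF_head n (p : X) (f : G) : Prop :=
  exists2 x : CF_Xn T n, p = CF_pt x & (\val x).1 = f.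

Lemma CF_headP p : exists n f, CF_head n p f.
Proof.
rewrite -[p]reprK; case: (repr p) => n x.
by exists n, (\val x).1; exists x.
Qed.

Lemma head_uniq n p f f' : CF_head n p f -> CF_head n p f' -> f = f'.
Proof. by move=> [x -> <-] [y /CF_pt_inj -> <-]. Qed.

Lemma head_F n p f : CF_head n p f -> f \in F n.
Proof. by move=> [x _ <-]; exact: CF_Xn_F. Qed.

Lemma head_succ n p f : CF_head n p f ->
  exists2 c, c \in C n.+1 & CF_head n.+1 p (f * c).
Proof.
move=> [x -> <-]; exists ((\val x).2 0%N).
  by have := CF_Xn_C x 0; rewrite addn0.
by exists (CF_embed x); rewrite ?CF_pt_embed.
Qed.

(** Prepending [c] to the tail of the point of $X_{n+1}$ gives a point of $X_n$ that embeds onto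
    it. *)
Lemma head_pred n p f c : f \in F n -> c \in C n.+1 -> CF_head n.+1 p (f * c) ->
  CF_head n p f.
Proof.
move=> fF cC [x -> xf].
have [|y y1 y2] := @CF_Xn_mk n f (fun i => if i is j.+1 then (\val x).2 j else c) fF.
  by move=> [|i]; rewrite ?addn0// addnS -addSn; exact: CF_Xn_C.
exists y => //; rewrite -(CF_pt_embed y); suff -> : CF_embed y = x by [].
by apply: CF_Xn_inj; rewrite /= ?y1 ?y2.
Qed.

Lemma head_up n m p f : (n <= m)%N -> CF_head n p f ->
  exists2 c, c \in P n m & CF_head m p (f * c).
Proof.
move=> + pf; elim: m => [|m IH].
  by rewrite leqn0 => /eqP n0; subst n; exists 1; rewrite ?prodCnn ?inE ?mulg1.
rewrite leq_eqVlt => /predU1P [e|].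
  by subst n; exists 1; rewrite ?prodCnn ?inE ?mulg1.
rewrite ltnS => nm; have [c cP /head_succ [d dC]] := IH nm.
by exists (c * d); rewrite ?mulgA// prodC_recr// mem_fset_mul.
Qed.

Lemma head_down n m p f c : (n <= m)%N -> f \in F n -> c \in P n m ->
  CF_head m p (f * c) -> CF_head n p f.
Proof.
move=> + fF; elim: m c => [|m IH] c.
  by rewrite leqn0 => /eqP n0; subst n; rewrite prodCnn => /fset1P ->; rewrite mulg1.
rewrite leq_eqVlt => /predU1P [e|].
  by subst n; rewrite prodCnn => /fset1P ->; rewrite mulg1.
rewrite ltnS => nm; rewrite prodC_recr// => /fset_mulP [d [e [dP eC ->]]].
rewrite mulgA => h; apply: (IH d) => //.
exact: head_pred (F_prodC nm fF dP) eC h.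
Qed.

Lemma head_downE n m p f g : (n <= m)%N -> CF_head n p f -> CF_head m p g ->
  exists2 c, c \in P n m & g = f * c.
Proof.
move=> nm /(head_up nm) [c cP h] h'; exists c => //; exact: head_uniq h' h.
Qed.

Lemma head_ex p N : exists n f, (N <= n)%N /\ CF_head n p f.
Proof.
have [n [f pf]] := CF_headP p; have [c _ h] := head_up (leq_addr N n) pf.
by exists (n + N)%N, (f * c); rewrite leq_addl.
Qed.

(** The partial product $fc_0\cdots c_{k-1}$, which is the head at level $n+k$ of the point
    $(f,c_0,c_1,\dots)$ of $X_n$. *)
Fixpoint walk (f : G) (c : nat -> G) k :=
  if k is j.+1 then walk f c j * c j else f.

Lemma walkS f c k : walk (f * c 0%N) (fun i => c i.+1) k = walk f c k.+1.
Proof. by elim: k => //= k ->. Qed.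

Lemma head_walk n (x : CF_Xn T n) k :
  CF_head (n + k) (CF_pt x) (walk (\val x).1 (\val x).2 k).
Proof.
elim: k n x => [|k IH] n x; first by rewrite addn0; exists x.
by have := IH _ (CF_embed x); rewrite /= walkS CF_pt_embed addnS addSn.
Qed.

(** Quotients of successive heads are the coordinates $c_i$, so the heads from any level on
    determine a point. *)
Lemma head_ext N p q :
  (forall n f, (N <= n)%N -> CF_head n p f -> CF_head n q f) -> p = q.
Proof.
move=> pq; have [n [f [Nn pf]]] := head_ex p N.
have := pq _ _ Nn pf; move: pf => [x xp xf] [y yq yf].
have e k : walk (\val x).1 (\val x).2 k = walk (\val y).1 (\val y).2 k.
  have h := head_walk x k; rewrite -xp in h.
  have := pq _ _ (leq_trans Nn (leq_addr k n)) h; rewrite yq => h'.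
  exact: head_uniq h' (head_walk y k).
rewrite xp yq; suff -> : x = y by []; apply: CF_Xn_inj; first by rewrite xf yf.
by move=> i; have /= := e i.+1; rewrite e => /mulgI.
Qed.

Lemma head_seq n (h : nat -> G) : h 0%N \in F n ->
  (forall i, (h i)^-1 * h i.+1 \in C (n + i).+1) ->
  exists p, forall i, CF_head (n + i) p (h i).
Proof.
move=> h0 hC; have [x x1 x2] := CF_Xn_mk h0 hC.
exists (CF_pt x) => i; suff <- : walk (\val x).1 (\val x).2 i = h i by exact: head_walk.
by elim: i => [//|i /= ->]; rewrite x2 mulVKg.
Qed.

(** Equal tails mean that left multiplication by [g] propagates from one head to all later ones.
    Conversely, cancelling [g] and the common head gives equal tails. *)
Lemma head_actP g (p q : X) : CF_act g p q <-> exists n, [/\ exists f, CF_head n p f &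
  forall m f, (n <= m)%N -> CF_head m p f -> CF_head m q (g * f)].
Proof.
split=> [[n [x [y [-> -> e1 e2]]]]|[n [[f pf] h]]].
  exists n; split; first by exists (\val x).1, x.
  move=> m f nm hf; rewrite -(subnKC nm) in hf *.
  rewrite (head_uniq hf (head_walk x _)).
  suff <- : walk (\val y).1 (\val y).2 (m - n) = g * walk (\val x).1 (\val x).2 (m - n).
    exact: head_walk.
  by rewrite e1 e2; elim: (m - n)%N => //= k ->; rewrite mulgA.
have := h _ _ (leqnn n) pf; move: pf => [x xp xf] [y yq yf].
exists n, x, y; split=> //; first by rewrite yf xf.
have e k : walk (\val y).1 (\val y).2 k = g * walk (\val x).1 (\val x).2 k.
  have hk := head_walk x k; rewrite -xp in hk.
  have := h _ _ (leq_addr k n) hk; rewrite yq => h'.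
  exact: head_uniq (head_walk y k) h'.
by apply/funext => i; have /= := e i.+1; rewrite e -mulgA => /mulgI/mulgI.
Qed.

Lemma act_uniq g (p q q' : X) : CF_act g p q -> CF_act g p q' -> q = q'.
Proof.
move=> /head_actP [n [[f pf] h]] /head_actP [n' [_ h']].
apply: (@head_ext (maxn n n')) => m f'; rewrite geq_max => /andP [nm n'm] qf'.
have [c _ pm] := head_up nm pf.
by rewrite (head_uniq qf' (h _ _ nm pm)); exact: h'.
Qed.

Lemma act_inv g (p q : X) : CF_act g p q -> CF_act g^-1 q p.
Proof.
by move=> [n [x [y [-> -> e1 e2]]]]; exists n, y, x; rewrite e1 mulKg.
Qed.

Lemma act_invP g (p q : X) : CF_act g^-1 q p -> CF_act g p q.
Proof. by move/act_inv; rewrite invgK. Qed.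

Lemma cylP n A p : CF_cyl n A p <-> exists2 f, f \in A & CF_head n p f.
Proof.
split=> [[x xA <-]|[f fA [x -> xf]]]; first by exists (\val x).1 => //; exists x.
by exists x => //=; rewrite xf.
Qed.

End Heads.

(** * Topology of the inductive limit: cylinders, separation, compactness *)

Section CylinderTopology.
Variables (G : groupType) (T : CFseq G).
Local Notation F := (CF_F T).
Local Notation C := (CF_C T).
Local Notation P := (CF_prodC T).
Local Notation X := (CF_space T).
Local Notation Z := (discrete_topology G * {ptws nat -> discrete_topology G})%type.

Lemma nbhs_ptws_discrete (c : {ptws nat -> discrete_topology G}) W :
  nbhs c W <-> exists N, forall c', (forall i, (i < N)%N -> c' i = c i) -> W c'.
Proof.
have Fc : Filter (nbhs c) by exact: nbhs_filter.
split=> [cW|[N h]]; last first.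
  suff : nbhs c [set c' | forall i, (i < N)%N -> c' i = c i].
    by apply: filterS => c'; exact: h.
  elim: N {h} => [|N IH]; first exact: filterS (filterT).
  have hN : nbhs c [set c' : {ptws nat -> discrete_topology G} | c' N = c N].
    exact: (@proj_continuous _ (fun=> discrete_topology G) N c [set c N]
      (discrete_set1 (c N : discrete_topology G))).
  apply: filterS2 IH hN => c' h e i; rewrite ltnS leq_eqVlt => /predU1P [->//|].
  exact: h.
pose B := fun N => [set c' : {ptws nat -> discrete_topology G} |
  forall i, (i < N)%N -> c' i = c i].
have FF : Filter (filter_from setT B).
  apply: filter_from_filter; first by exists 0%N.
  move=> i j _ _; exists (maxn i j) => // c' h; split => k kl; apply: h;
  by rewrite leq_max kl ?orbT.
(* The filter generated by the sets [B N] converges to [c] in each coordinate, hence contains every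
   neighbourhood of [c]. *)
have : {ptws, filter_from setT B --> c}.
  apply/(@pointwise_cvgP nat (discrete_topology G)) => t A At.
  exists t.+1 => // c' /(_ t (ltnSn t)) /= ->; exact: nbhs_singleton At.
by move=> /(_ W cW) [N _ h]; exists N => c'; exact: h.
Qed.

Lemma nbhs_agree (z : Z) N :
  nbhs z [set z' : Z | z'.1 = z.1 /\ forall i, (i < N)%N -> z'.2 i = z.2 i].
Proof.
exists ([set z.1], [set c | forall i, (i < N)%N -> c i = z.2 i]) => /=.
  split=> /=; first exact: discrete_set1.
  by apply/nbhs_ptws_discrete; exists N.
by move=> z' [/= z1 z2]; split.
Qed.

Lemma nbhs_CF_Xn n (x : CF_Xn T n) V :
  nbhs x V <-> exists N, forall y : CF_Xn T n, (\val y).1 = (\val x).1 ->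
    (forall i, (i < N)%N -> (\val y).2 i = (\val x).2 i) -> V y.
Proof.
split=> [|[N h]].
  rewrite nbhsE => -[_ [[W oW <-] Wx] WV].
  have /= : nbhs (\val x) W by exact: open_nbhs_nbhs.
  move=> [[A B] /= [xA /nbhs_ptws_discrete [N h]] AB].
  exists N => y e1 e2; apply: WV; apply: (AB (\val y)); split => /=; last exact: h.
  by rewrite e1; exact: nbhs_singleton xA.
have : nbhs x (set_val @^-1` [set z : Z | z.1 = (\val x).1 /\
    forall i, (i < N)%N -> z.2 i = (\val x).2 i]).
  by apply: initial_continuous; exact: nbhs_agree.
by apply: filterS => y [y1 y2]; exact: h.
Qed.

Lemma open_CF_pt (U : set X) : open U <-> forall n, open (@CF_pt G T n @^-1` U).
Proof. exact: (sigT_openP (X := fun n => CF_Xn T n)). Qed.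

(** The sets of points with a prescribed head form a base: fixing the head at level $n+N$ fixes the
    $F_n$-coordinate and the next [N] coordinates. *)
Lemma open_headP (U : set X) : open U <-> forall p, U p ->
  exists n f, CF_head n p f /\ forall p', CF_head n p' f -> U p'.
Proof.
rewrite open_CF_pt; split=> [oU p Up|h n].
  have [n [_ [x xp _]]] := CF_headP p.
  have /nbhs_CF_Xn [N h] : nbhs x (@CF_pt G T n @^-1` U).
    by apply: open_nbhs_nbhs; split=> //=; rewrite -xp.
  have px := head_walk x; rewrite -xp in px.
  exists (n + N)%N, (walk (\val x).1 (\val x).2 N); split=> // p' hp'.
  have wP i : (i <= N)%N -> exists2 c, c \in P (n + i) (n + N) &
      walk (\val x).1 (\val x).2 N = (walk (\val x).1 (\val x).2 i * c)%g.
    by move=> iN; apply: (head_downE _ (px i) (px N)); rewrite leq_add2l.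
  have [c cP wN] := wP 0%N (leq0n N); rewrite addn0 in cP.
  have [y yp' y1] : CF_head n p' (\val x).1.
    by apply: head_down cP _; rewrite ?leq_addr ?CF_Xn_F// -wN.
  have py := head_walk y; rewrite -yp' in py.
  have wE i : (i <= N)%N -> walk (\val y).1 (\val y).2 i = walk (\val x).1 (\val x).2 i.
    move=> iN; have [d dP e] := wP i iN.
    have ij : (n + i <= n + N)%N by rewrite leq_add2l.
    have [d' d'P e'] := head_downE ij (py i) hp'.
    rewrite e in e'.
    by have [-> _] := F_prodC_inj ij (head_F (px i)) (head_F (py i)) dP d'P e'.
  rewrite yp'; apply: h => // i iN.
  have e := wE i (ltnW iN); have := wE i.+1 iN.
  rewrite ![walk _ _ i.+1]/(walk _ _ i * _ i)%g e; exact: mulgI.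
rewrite openE => x /= /h [m [f [xf hf]]]; apply/nbhs_CF_Xn.
have mn : (m <= n + (m - n))%N by rewrite -leq_subLR.
have [c cP hw] := head_downE mn xf (head_walk x (m - n)).
exists (m - n)%N => y e1 e2; apply: hf.
apply: (head_down mn (head_F xf) cP); rewrite -hw.
have <- : walk (\val y).1 (\val y).2 (m - n) = walk (\val x).1 (\val x).2 (m - n).
  elim: (m - n)%N e2 => [_|k IH e2] //=.
  by rewrite e2// IH// => i ik; apply: e2; exact: ltnW.
exact: head_walk.
Qed.

Lemma open_cyl n A : open (CF_cyl n A : set X).
Proof.
apply/open_headP => p /cylP [f fA pf]; exists n, f; split=> // p' p'f.
by apply/cylP; exists f.
Qed.

Lemma hausdorff_CF_space : hausdorff_space X.
Proof.
rewrite open_hausdorff => p q pq.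
(* Distinct points have different heads at some common level, and the corresponding one-element
   cylinders are disjoint and open. *)
suff [n [f [g [pf qg fg]]]] : exists n f g, [/\ CF_head n p f, CF_head n q g & f <> g].
  exists (CF_cyl n [fset f]%fset, CF_cyl n [fset g]%fset).
    by split; apply/mem_set/cylP; [exists f|exists g] => //; rewrite inE.
  split; [exact: open_cyl|exact: open_cyl|].
  apply/eqP/seteqP; split=> // r [/cylP [_ /fset1P -> rf] /cylP [_ /fset1P -> rg]].
  exact: fg (head_uniq rf rg).
have [n [f [_ pf]]] := head_ex p 0; have [m [g [nm qg]]] := head_ex q n.
apply: contrapT => h; move/eqP: pq; apply; apply: (@head_ext _ _ m) => k g' mk pg'.
have [d _ qg'] := head_up mk qg.
have [e|ne] := pselect (g' = g * d)%g; first by rewrite e.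
by case: h; exists k, g', (g * d)%g.
Qed.

(** The cylinder is a continuous image of $A\times C_{n+1}\times C_{n+2}\times\cdots$, compact by
    Tychonoff. *)
Lemma compact_cyl n A : (A `<=` F n)%fset -> compact (CF_cyl n A : set X).
Proof.
move=> /fsubsetP AF.
pose K : set Z := [set z | z.1 \in A /\ forall i, z.2 i \in C (n + i).+1].
have cfin (B : {fset G}) : compact ([set b | b \in B] : set (discrete_topology G)).
  exact/finite_compact/finite_fset.
have cK : compact K.
  have := compact_setX (cfin A) (@tychonoff _ (fun=> discrete_topology G) _
    (fun i => cfin (C (n + i).+1))).
  by apply.
(* A total extension of [CF_pt]. The default value is harmless: [K] lies in $X_n$ and continuity is
   only claimed on [K]. *)
pose h (z : Z) : X := match pselect (z \in CF_Xn_set T n) with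
  | left zP => CF_pt (SigSub zP : CF_Xn T n) | right _ => point end.
have hE (x : CF_Xn T n) : h (\val x) = CF_pt x.
  rewrite /h; case: pselect => [xP|]; last by have := valP x.
  by have -> : (SigSub xP : CF_Xn T n) = x by exact: val_inj.
have KX z : K z -> exists x : CF_Xn T n, \val x = z.
  move=> [z1 z2]; have [x x1 x2] := @CF_Xn_mk _ T n z.1 z.2 (AF _ z1) z2.
  by exists x; case: z x1 x2 {z1 z2} => a b /=; case: (\val x) => ? ? /= -> ->.
have -> : CF_cyl n A = h @` K.
  apply/seteqP; split=> [_ [x xA <-]|_ [z Kz <-]].
    exists (\val x); last exact: hE.
    by split; [exact: xA|exact: CF_Xn_C].
  have [x xz] := KX _ Kz; rewrite -xz hE; exists x => //=.
  by rewrite xz; case: Kz.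
apply: continuous_compact => //.
apply/subspace_continuousP => z Kz U.
have [x xz] := KX _ Kz; have hz : h z = CF_pt x by rewrite -xz hE.
rewrite [from_subspace _ _ _]hz nbhsE => -[V [oV Vx] VU].
have /nbhs_CF_Xn [N hN] : nbhs x (@CF_pt G T n @^-1` V).
  by apply: open_nbhs_nbhs; split=> //; exact: ((open_CF_pt V).1 oV n).
apply: filterS (nbhs_agree z N) => z' [e1 e2] /KX [y yz'].
have : V (CF_pt y) by apply: hN; rewrite ?yz' ?xz.
by rewrite -hE yz' => /VU.
Qed.

(** Since $G$ is countable, this is a countable union, which reduces measurability questions for
    open sets to single heads. *)
Lemma open_bigcup_head (U : set X) : countable [set: G] -> open U ->
  U = \bigcup_(u in [set u : nat * G | CF_head u.1 ^~ u.2 `<=` U])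
        (CF_head u.1 ^~ u.2).
Proof.
move=> cG /open_headP oU; apply/seteqP; split=> [p /oU [n [f [pf fU]]]|p [u uU up]].
  by exists (n, f).
exact: uU.
Qed.

Lemma measurable_cyl n A : measurable (CF_cyl n A : set (CF_borel T)).
Proof. by apply: sub_sigma_algebra; exact: open_cyl. Qed.

Lemma compact_measurable (K : set X) : compact K -> measurable (K : set (CF_borel T)).
Proof.
move=> cK; rewrite -[K]setCK; apply: measurableC; apply: sub_sigma_algebra.
rewrite openC; apply: compact_closed cK; exact: hausdorff_CF_space.
Qed.

End CylinderTopology.

(* S is obtained from T by keeping the levels k 0 < k 1 < ... and discarding
   part of the products C_{k j + 1} ... C_{k (j + 1)}. *)
Record telescopes (G : groupType) (T S : CFseq G) (k : nat -> nat) : Prop :=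
  Telescopes {
    tel_lt : forall j, (k j < k j.+1)%N;
    tel_F : forall j, CF_F S j = CF_F T (k j);
    tel_C : forall j c, c \in CF_C S j.+1 -> c \in CF_prodC T (k j) (k j.+1)
  }.

(** * The equivariant embedding of the telescoped space and its inverse *)

Section Telescoping.
Variables (G : groupType) (T S : CFseq G) (k : nat -> nat).
Hypothesis tel : telescopes T S k.
Local Notation X := (CF_space T).
Local Notation Y := (CF_space S).

Lemma tel_mono : {homo k : i j / (i <= j)%N}.
Proof. by apply: homo_leq (leqnn) (leq_trans) _ => j; exact: ltnW (tel_lt tel j). Qed.

Lemma tel_ge j : (j <= k j)%N.
Proof. by elim: j => // j IH; exact: leq_ltn_trans IH (tel_lt tel j). Qed.

Lemma tel_prodC i j c : (i <= j)%N -> c \in CF_prodC S i j ->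
  c \in CF_prodC T (k i) (k j).
Proof.
elim: j c => [|j IH] c; first by case: i => // _; rewrite !prodCnn.
rewrite leq_eqVlt => /predU1P [->|]; first by rewrite !prodCnn.
rewrite ltnS => ij; rewrite prodC_recr// => /fset_mulP [a [b [aP bC ->]]].
rewrite (prodC_cat T (tel_mono ij) (ltnW (tel_lt tel j))).
by apply: mem_fset_mul; [exact: IH|exact (tel_C tel bC)].
Qed.

(* The T-heads of the point of X lying over q are read off backwards from its
   heads at the levels k j. *)
Lemma iota_exists (q : Y) : exists p : X,
  forall j f, CF_head j q f -> CF_head (k j) p f.
Proof.
have [N [f0 [_ q0]]] := head_ex q 0.
(* The value below level [N], where [q] may have no head, is a dummy. *)
have /choice [h hP] : forall j, exists f, (N <= j)%N -> CF_head j q f.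
  move=> j; have [Nj|_] := leqP N j; last by exists 1%g.
  by have [c _ qc] := head_up Nj q0; exists (f0 * c)%g.
have hF j : (N <= j)%N -> h j \in CF_F T (k j).
  by move=> Nj; rewrite -(tel_F tel); exact: head_F (hP j Nj).
have hS i j : (N <= i)%N -> (i <= j)%N -> exists2 c, c \in CF_prodC T (k i) (k j) &
    h j = (h i * c)%g.
  move=> Ni ij; have [c cP e] := head_downE ij (hP i Ni) (hP j (leq_trans Ni ij)).
  by exists c => //; exact: tel_prodC.
(* As $m\le k_m$, the head at level [m] must be the $F_m$-part of [h m], an element of $F_{k_m}$. *)
have /choice [g gP] : forall m, exists g, (k N <= m)%N ->
    g \in CF_F T m /\ exists2 c, c \in CF_prodC T m (k m) & h m = (g * c)%g.
  move=> m; have [kNm|_] := leqP (k N) m; last by exists 1%g.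
  have Nm := leq_trans (tel_ge N) kNm.
  have [c] := hS N m (leqnn N) Nm.
  rewrite (prodC_cat T kNm (tel_ge m)) => /fset_mulP [a [b [aP bP ->]]] e.
  exists (h N * a)%g => _; split; first exact: F_prodC (hF N _) aP.
  by exists b; rewrite // e mulgA.
have gS m : (k N <= m)%N -> exists2 c, c \in CF_C T m.+1 & g m.+1 = (g m * c)%g.
  move=> kNm; have kNm1 := leq_trans kNm (leqnSn m).
  have Nm := leq_trans (tel_ge N) kNm.
  have [gF [c cP hm]] := gP m kNm; have [gF1 [c1 c1P hm1]] := gP m.+1 kNm1.
  have [d dP e] := hS m m.+1 Nm (leqnSn m).
  have : (c * d)%g \in CF_prodC T m (k m.+1).
    by rewrite (prodC_cat T (tel_ge m) (ltnW (tel_lt tel m))) mem_fset_mul.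
  rewrite (prodC_cat T (leqnSn m) (tel_ge m.+1)) prodC1.
  move=> /fset_mulP [a [b [aC bP cdE]]]; exists a => //.
  have gaF : (g m * a)%g \in CF_F T m.+1.
    by apply: (F_prodC (leqnSn m)) gF _; rewrite prodC1.
  have gab : (g m.+1 * c1 = g m * a * b)%g by rewrite -hm1 e hm -!mulgA cdE.
  by have [] := F_prodC_inj (tel_ge m.+1) gF1 gaF c1P bP gab.
have [||p pP] := @head_seq _ T (k N) (fun i => g (k N + i)%N).
- by rewrite addn0; case: (gP _ (leqnn (k N))).
- move=> i; have [c cC] := gS (k N + i)%N (leq_addr _ _).
  by rewrite addnS => ->; rewrite mulKg.
have pP' m : (k N <= m)%N -> CF_head m p (g m).
  by move=> kNm; have := pP (m - k N)%N; rewrite subnKC.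
have ph j : (N <= j)%N -> CF_head (k j) p (h j).
  move=> Nj; have kNj := tel_mono Nj.
  have [gF [c cP e]] := gP _ kNj; have [d dP e'] := hS j (k j) Nj (tel_ge j).
  have kjj : (k j <= k (k j))%N by exact: tel_ge.
  rewrite e in e'.
  have [<- _] := F_prodC_inj kjj gF (hF j Nj) cP dP e'.
  exact: pP'.
exists p => j f qf; have jM := leq_maxr N j; have NM := leq_maxl N j.
have [c cP e] := head_downE jM qf (hP _ NM).
apply: (head_down (tel_mono jM) _ (tel_prodC jM cP)); first by rewrite -(tel_F tel); exact: head_F qf.
by rewrite -e; exact: ph.
Qed.

Definition iota_tel (q : Y) : X := projT1 (cid (iota_exists q)).
Local Notation iota := iota_tel.

Lemma iota_head j q f : CF_head j q f -> CF_head (k j) (iota q) f.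
Proof. by rewrite /iota; case: cid => p /= pP; exact: pP. Qed.

Lemma iota_inj : injective iota.
Proof.
move=> q q' e; have [N [g [_ q'g]]] := head_ex q' 0.
apply: (@head_ext _ _ N) => j f Nj qf; have [c _ q'c] := head_up Nj q'g.
have := iota_head qf; rewrite e => /head_uniq/(_ (iota_head q'c)) ->.
exact: q'c.
Qed.

Lemma head_ext_tel N (p p' : X) :
  (forall j, (N <= j)%N -> exists2 f, CF_head (k j) p f & CF_head (k j) p' f) ->
  p = p'.
Proof.
move=> h; apply: (@head_ext _ _ 0) => n f _ pf.
have [g pg p'g] := h _ (leq_maxl N n).
have nk : (n <= k (maxn N n))%N by exact: leq_trans (leq_maxr _ _) (tel_ge _).
have [c cP e] := head_downE nk pf pg.
by apply: (head_down nk (head_F pf) cP); rewrite -e.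
Qed.

(** A point lies in the image exactly when all its heads at the levels [k (n + i)] factor through
    the thinned sets. This writes the image as a countable intersection of cylinders, from which
    both its measurability and its measure follow. *)
Lemma iota_cyl n A : (A `<=` CF_F S n)%fset ->
  iota @` CF_cyl n A =
  \bigcap_i CF_cyl (k (n + i)) (fset_mul A (CF_prodC S n (n + i))).
Proof.
move=> /fsubsetP AF; apply/seteqP; split=> [_ [q /cylP [f fA qf] <-] i _|p pP].
  have [c cP qc] := head_up (leq_addr i n) qf.
  by apply/cylP; exists (f * c)%g; [exact: mem_fset_mul|exact: iota_head].
have /choice [h hP] : forall i, exists f, f \in fset_mul A (CF_prodC S n (n + i)) /\
    CF_head (k (n + i)) p f.
  by move=> i; have /cylP [f fA pf] := pP i I; exists f.
have [h0 _] := hP 0%N; rewrite addn0 prodCnn fset_muls1 in h0.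
have hC i : ((h i)^-1 * h i.+1)%g \in CF_C S (n + i).+1.
  have [] := hP i.+1; rewrite addnS prodC_recr ?leq_addr// fset_mulA.
  move=> /fset_mulP [a [d [/fset_mulP [b [c [bA cP ->]]] dC ->]]] pd.
  suff -> : h i = (b * c)%g by rewrite mulKg.
  apply: head_uniq (hP i).2 _.
  have dP := tel_C tel dC; apply: head_down (ltnW (tel_lt tel (n + i))) _ dP pd.
  by rewrite -(tel_F tel); apply: F_prodC cP; [exact: leq_addr|exact: AF].
have [q qP] := head_seq (AF _ h0) hC.
exists q; first by apply/cylP; exists (h 0%N) => //; have := qP 0%N; rewrite addn0.
apply: (@head_ext_tel n) => j nj; exists (h (j - n)%N).
  by have := iota_head (qP (j - n)%N); rewrite subnKC.
by have [_] := hP (j - n)%N; rewrite subnKC.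
Qed.

Lemma iota_continuous : continuous iota.
Proof.
apply/continuousP => U /open_headP oU; apply/open_headP => q /= /oU [n [f [pf hf]]].
have [j [f' [nj qf']]] := head_ex q n; exists j, f'; split=> // q' q'f'; apply: hf.
have nk := leq_trans nj (tel_ge j).
have [c cP e] := head_downE nk pf (iota_head qf').
by apply: (head_down nk (head_F pf) cP); rewrite -e; exact: iota_head.
Qed.

Lemma iota_act g q q' : CF_act g (iota q) (iota q') <-> CF_act g q q'.
Proof.
split=> /head_actP [n [[f0 pf0] h]]; apply/head_actP.
  have [m [f [nm qf]]] := head_ex q n; have [m' [f' [mm' q'f']]] := head_ex q' m.
  exists m'; split; first by have [c _ qc] := head_up mm' qf; exists (f * c)%g.
  move=> j a m'j qa; have [d _ q'd] := head_up m'j q'f'.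
  have nj : (n <= k j)%N.
    exact: leq_trans nm (leq_trans mm' (leq_trans m'j (tel_ge j))).
  by rewrite (head_uniq (h _ _ nj (iota_head qa)) (iota_head q'd)).
exists (k n); split; first by exists f0; exact: iota_head.
(* The level [m] need not be of the form [k j], so the relation is checked at level [k m] and
   brought down to [m]. *)
move=> m f nm pf; have mk := tel_ge m; have nm' := leq_trans (tel_ge n) nm.
have [c cP e] := head_downE nm (iota_head pf0) pf.
have gfF : (g * f)%g \in CF_F T m.
  rewrite e mulgA; apply: F_prodC nm _ cP.
  by rewrite -(tel_F tel); exact: head_F (h _ _ (leqnn n) pf0).
have [d _ qd] := head_up nm' pf0.
have [a aP e'] := head_downE mk pf (iota_head qd).
apply: (head_down mk gfF aP); rewrite -mulgA -e'.
exact: iota_head (h _ _ nm' qd).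
Qed.

(** The inverse of the embedding, made total by sending everything outside the image to the base
    point. *)
Definition tel_back (p : X) : Y :=
  if pselect (exists q, iota q = p) is left h then projT1 (cid h) else point.
Local Notation phi := tel_back.

Lemma tel_backK p : range iota p -> iota (phi p) = p.
Proof.
move=> [q _ qp]; rewrite /phi; case: pselect => [h|[]]; last by exists q.
exact: projT2 (cid h).
Qed.

Lemma tel_back_out p : ~ range iota p -> phi p = point.
Proof.
rewrite /phi; case: pselect => // h []; have [q qp] := h; by exists q.
Qed.

Lemma iotaK : cancel iota phi.
Proof. by move=> q; apply: iota_inj; apply: tel_backK; exists q. Qed.

Lemma preimage_tel_back B :
  phi @^-1` B = iota @` B `|` (~` range iota `&` [set p | B point]).
Proof.
apply/seteqP; split=> p /=.
  have [rp Bp|rp] := pselect (range iota p).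
    by left; exists (phi p) => //; exact: tel_backK.
  by rewrite tel_back_out// => Bp; right.
by move=> [[q Bq <-]|[rp Bp]]; rewrite ?iotaK ?tel_back_out.
Qed.

Lemma measurable_iota_cyl n A : (A `<=` CF_F S n)%fset ->
  measurable (iota @` CF_cyl n A : set (CF_borel T)).
Proof.
move=> AF; rewrite iota_cyl//; apply: bigcapT_measurable => i.
exact: measurable_cyl.
Qed.

Lemma measurable_iota_head n f :
  measurable (iota @` (CF_head n ^~ f) : set (CF_borel T)).
Proof.
have [fF|fF] := boolP (f \in CF_F S n).
  have -> : CF_head n ^~ f = CF_cyl n [fset f]%fset :> set Y.
    apply/seteqP; split=> q; first by move=> qf; apply/cylP; exists f; rewrite ?inE.
    by move=> /cylP [_ /fset1P ->].
  by apply: measurable_iota_cyl; rewrite fsub1set.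
rewrite (_ : _ @` _ = set0); first exact: measurable0.
by apply/seteqP; split=> // p [q /head_F qF]; rewrite qF in fF.
Qed.

Lemma range_iota : range iota = \bigcup_n (iota @` CF_cyl n (CF_F S n)).
Proof.
apply/seteqP; split=> [_ [q _ <-]|p [n _ [q _ <-]]]; last by exists q.
have [n [f qf]] := CF_headP q; exists n => //; exists q => //.
by apply/cylP; exists f => //; exact: head_F qf.
Qed.

Lemma measurable_range_iota : measurable (range iota : set (CF_borel T)).
Proof.
rewrite range_iota; apply: bigcupT_measurable => n; exact: measurable_iota_cyl.
Qed.

Lemma measurable_iota : measurable_fun [set: CF_borel S] (iota : CF_borel S -> CF_borel T).
Proof.
apply: (@measurability _ _ (CF_borel S) (CF_borel T) setT iota (@open X)) => //.
move=> _ [U oU <-]; rewrite setTI; apply: sub_sigma_algebra.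
by move/continuousP : iota_continuous; exact.
Qed.

Lemma measurable_tel_back : countable [set: G] ->
  measurable_fun [set: CF_borel T] (phi : CF_borel T -> CF_borel S).
Proof.
move=> cG; apply: (@measurability _ _ (CF_borel T) (CF_borel S) setT phi (@open Y)) => //.
move=> _ [U oU <-]; rewrite setTI preimage_tel_back; apply: measurableU; last first.
  apply: measurableI; first by apply: measurableC; exact: measurable_range_iota.
  have [Up|Up] := pselect (U point).
    by rewrite (_ : [set _ | _] = setT)//; apply/seteqP; split.
  by rewrite (_ : [set _ | _] = set0)//; apply/seteqP; split.
rewrite (open_bigcup_head cG oU) image_bigcup bigcup_mkcond.
apply: countable_bigcupT_measurable => [|u].
  by rewrite -setXTT; exact: countableX.
by case: ifP => _; [exact: measurable_iota_head|exact: measurable0].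
Qed.

End Telescoping.

(** * Images of sets under the partial transformations; compact sets and levels *)

Section CylinderActions.
Variables (G : groupType) (T : CFseq G).
Local Notation X := (CF_space T).
Local Open Scope group_scope.

Lemma act_total :
  (forall g, exists N, forall n f c, (N <= n)%N -> f \in CF_F T n ->
     c \in CF_C T n.+1 -> g * (f * c) \in CF_F T n.+1) ->
  forall g (p : X), exists q, CF_act g p q.
Proof.
move=> h g p; have [N hN] := h g; have [n [f [Nn pf]]] := head_ex p N.
have [c cC [x xp xf]] := head_succ pf.
have [||y y1 y2] := @CF_Xn_mk _ T n.+1 (g * (f * c)) (\val x).2.
- by apply: hN => //; exact: head_F pf.
- exact: CF_Xn_C.
by exists (CF_pt y), n.+1, x, y; rewrite y1 xf.
Qed.

Lemma open_graph_image g (U : set X) : open U -> open (graph_image (CF_act g) U).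
Proof.
move=> /open_headP oU; apply/open_headP => q [p Up /head_actP [m [_ h]]].
have [n [f [pf fU]]] := oU p Up.
have [M [a [nM pa]]] := head_ex p (maxn n m).
have [nM' mM] : (n <= M)%N /\ (m <= M)%N by move: nM; rewrite geq_max => /andP.
have qa := h M a mM pa.
exists M, (g * a); split=> // q' [y q'y y1].
have [x x1 x2] := CF_Xn_mk (head_F pa) (@CF_Xn_C _ _ _ y).
exists (CF_pt x); last by rewrite q'y; exists M, x, y; rewrite y1 x1 x2.
apply: fU; have [c cP e] := head_downE nM' pf pa.
by apply: (head_down nM' (head_F pf) cP); rewrite -e; exists x.
Qed.

(** Good-sets argument starting from open sets. Complements are handled by the injectivity of the
    partial map, taken relative to its full range. *)
Lemma measurable_graph_image g (B : set (CF_borel T)) : measurable B ->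
  measurable (graph_image (CF_act g) B : set (CF_borel T)).
Proof.
pose M := [set B : set (CF_borel T) |
  measurable (graph_image (CF_act g) B : set (CF_borel T))].
have mM (U : set X) : open U -> M U.
  by move=> oU; apply: sub_sigma_algebra; exact: open_graph_image.
apply: (@smallest_sub _ (sigma_algebra setT) (@open X) M) => //; split.
- by apply: mM; exact: open0.
- move=> A MA; rewrite /M /=; have -> : graph_image (CF_act g) (setT `\` A) =
      graph_image (CF_act g) setT `\` graph_image (CF_act g) A.
    apply/seteqP; split=> [q [p [_ Ap] pq]|q [[p _ pq] Aq]].
      split; first by exists p.
      move=> [p' Ap' p'q]; apply: Ap.
      by rewrite (act_uniq (act_inv pq) (act_inv p'q)).
    by exists p => //; split=> // Ap; apply: Aq; exists p.
  by apply: measurableD => //; apply: mM; exact: openT.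
- move=> A MA; rewrite /M /=; have -> : graph_image (CF_act g) (\bigcup_n A n) =
      \bigcup_n graph_image (CF_act g) (A n).
    apply/seteqP; split=> [q [p [n _ Ap] pq]|q [n _ [p Ap pq]]].
      by exists n => //; exists p.
    by exists p => //; exists n.
  exact: bigcupT_measurable.
Qed.

(** The sets $X_n$ form an increasing open cover. *)
Lemma compact_sub_cyl (K : set X) : compact K -> exists n, K `<=` CF_cyl n (CF_F T n).
Proof.
rewrite compact_cover => /(_ nat setT (fun n => CF_cyl n (CF_F T n))) [].
- by move=> n _; exact: open_cyl.
- move=> p _; have [n [f pf]] := CF_headP p; exists n => //.
  by apply/cylP; exists f => //; exact: head_F pf.
move=> D _ h; set m := (\max_(i : D) val i)%N; exists m => p /h [i iD /cylP [f _ pf]].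
have im : (i <= m)%N by exact: (leq_bigmax [` iD]%fset).
have [c _ pc] := head_up im pf.
by apply/cylP; exists (f * c) => //; exact: head_F pc.
Qed.

End CylinderActions.

Lemma scaled_pushforward (R : realType) (d d' : measure_display)
    (X : measurableType d) (Y : measurableType d')
    (mu : {measure set X -> \bar R}) (f : X -> Y) (a : R) :
  measurable_fun setT f -> 0 <= a ->
  exists nu : {measure set Y -> \bar R}, forall A, nu A = (a%:E * mu (f @^-1` A))%E.
Proof.
move=> mf a0.
unshelve eexists (mscale (NngNum a0) (pushforward mu f : {measure set Y -> \bar R})).
  exact: mf.
by [].
Qed.

(** * Measure of the image of the embedding *)

Section ConullImage.
Variables (R : realType) (G : groupType) (T S : CFseq G) (k : nat -> nat).
Hypothesis tel : telescopes T S k.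
Local Notation X := (CF_space T).
Local Notation Y := (CF_space S).
Local Notation iota := (iota_tel tel).
Local Notation phi := (tel_back tel).

Let prodT m : R := (\prod_(1 <= i < m.+1) #|` CF_C T i|)%:R.
Let prodS m : R := (\prod_(1 <= i < m.+1) #|` CF_C S i|)%:R.

Variable r : R.
Hypothesis r_gt0 : 0 < r.
Hypothesis r_cvg : (fun m => prodS m / prodT (k m)) @ \oo --> r.

Variable mu : {measure set (CF_borel T) -> \bar R}.
Hypothesis mu_cyl : forall n A, (A `<=` CF_F T n)%fset ->
  mu (CF_cyl n A) = (#|` A|%:R / prodT n)%:E.

Let prodT_gt0 m : 0 < prodT m.
Proof. by rewrite ltr0n prod_card_C_gt0. Qed.

Let prodS_gt0 m : 0 < prodS m.
Proof. by rewrite ltr0n prod_card_C_gt0. Qed.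

(** Continuity from above along the cylinders [E i]: the measure of [E i] is [#|A| / prodS n] times
    a ratio that tends to [r]. *)
Lemma mu_iota_cyl n A : (A `<=` CF_F S n)%fset ->
  mu (iota @` CF_cyl n A) = (r * (#|` A|%:R / prodS n))%:E.
Proof.
move=> AF; pose E i := CF_cyl (k (n + i)) (fset_mul A (CF_prodC S n (n + i))) : set X.
have subF i : (fset_mul A (CF_prodC S n (n + i)) `<=` CF_F T (k (n + i)))%fset.
  apply/fsubsetP => _ /fset_mulP [a [c [aA cP ->]]]; rewrite -(tel_F tel).
  by apply: F_prodC cP; [exact: leq_addr|exact: (fsubsetP AF)].
have muE i : mu (E i) =
    (#|` A|%:R / prodS n * (prodS (n + i) / prodT (k (n + i))))%:E.
  rewrite mu_cyl// card_mul_prodC ?leq_addr// card_prodC ?leq_addr//.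
  have -> : prodS (n + i) =
      prodS n * (\prod_(n.+1 <= j < (n + i).+1) #|` CF_C S j|)%:R.
    by rewrite -natrM -big_cat_nat //= ltnS leq_addr.
  by rewrite natrM [in RHS]mulrA [in RHS]mulrA divfK ?gt_eqF.
have ndE : {homo E : i j / (i <= j)%N >-> preorder.Order.le j i}.
  move=> i j ij; apply/subsetPset => p /cylP [_ /fset_mulP [a [c [aA cP ->]]] pj].
  have nij : (n + i <= n + j)%N by rewrite leq_add2l.
  rewrite (prodC_cat S (leq_addr i n) nij) in cP.
  have [c1 [c2 [c1P c2P e]]] := fset_mulP _ _ _ cP.
  apply/cylP; exists (a * c1)%g; first exact: mem_fset_mul.
  apply: (head_down (tel_mono tel nij) _ (tel_prodC tel nij c2P)).
    by apply: (fsubsetP (subF i)); exact: mem_fset_mul.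
  by rewrite -mulgA -e.
have mE i : measurable (E i : set (CF_borel T)) by exact: measurable_cyl.
have E0 : (mu (E 0%N) < +oo)%E by rewrite muE ltry.
have := nonincreasing_cvg_mu E0 mE (bigcapT_measurable mE) ndE.
rewrite iota_cyl// -/E => cvgE; apply: cvg_unique cvgE _ => //.
rewrite (_ : mu \o E = EFin \o fun i =>
  #|` A|%:R / prodS n * (prodS (n + i) / prodT (k (n + i)))); last first.
  by apply/funext => i; rewrite /= muE.
apply: cvg_EFin; first by near=> i.
rewrite [r * _]mulrC; apply: cvgM; first exact: cvg_cst.
have := r_cvg; rewrite -(cvg_shiftn n).
by under eq_fun do rewrite addnC.
Unshelve. all: by end_near. Qed.

Lemma mu_range_iota : mu (~` range iota) = 0%E.
Proof.
have mR : measurable (range iota : set (CF_borel T)) by exact: measurable_range_iota.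
have mCR : measurable (~` range iota : set (CF_borel T)) by exact: measurableC.
apply: (negligibleP mu mCR).1.
have -> : ~` range iota =
    \bigcup_n (CF_cyl (k n) (CF_F T (k n)) `\` range iota) :> set (CF_borel T).
  apply/seteqP; split=> [p rp|p [n _ []]//]; have [n [f pf]] := CF_headP p.
  exists n => //; split=> //; have [c _ pc] := head_up (tel_ge tel n) pf.
  by apply/cylP; exists (f * c)%g => //; exact: head_F pc.
apply: negligible_bigcup => n.
set E := CF_cyl _ _; have mE : measurable (E : set (CF_borel T)) by exact: measurable_cyl.
apply: (negligibleP mu _).2; first exact: measurableD.
set c : R := #|` CF_F T (k n)|%:R / prodT (k n).
have muE : mu E = c%:E by exact: mu_cyl.
have Eoo : (mu E < +oo)%E by rewrite muE ltry.
(* At level [k m] the set [E] is the cylinder over [B], and [B] also lies in $F'_m$. The points over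
   [B] already in the image of $X'_m$ have measure $c\,r$ divided by the ratio at [m], which tends
   to $c$. *)
have le m : (n <= m)%N -> (mu (E `\` range iota) <= (c - c * (r / (prodS m / prodT (k m))))%:E)%E.
  move=> nm; pose B := fset_mul (CF_F T (k n)) (CF_prodC T (k n) (k m)).
  have knm := tel_mono tel nm.
  have BF : (B `<=` CF_F T (k m))%fset.
    by apply/fsubsetP => _ /fset_mulP [f [d [fF dP ->]]]; exact: F_prodC dP.
  have EB : E = CF_cyl (k m) B.
    apply/seteqP; split=> p /cylP [f fF pf]; apply/cylP.
      have [d dP pd] := head_up knm pf.
      by exists (f * d)%g => //; exact: mem_fset_mul.
    have [a [d [aF dP e]]] := fset_mulP _ _ _ fF.
    by exists a => //; apply: head_down knm aF dP _; rewrite -e.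
  have cE : c = #|` B|%:R / prodT (k m).
    by apply: EFin_inj; rewrite -muE EB mu_cyl.
  have BFS : (B `<=` CF_F S m)%fset by rewrite (tel_F tel).
  have mI := measurable_iota_cyl tel BFS.
  have IE : iota @` CF_cyl m B `<=` E.
    rewrite EB => _ [q /cylP [f fB qf] <-]; apply/cylP; exists f => //.
    exact: iota_head.
  apply: (@le_trans _ _ (mu (E `\` iota @` CF_cyl m B))).
    apply: le_measure; rewrite ?inE; [exact: measurableD|exact: measurableD|].
    by move=> p [Ep rp]; split=> // -[q _ qp]; apply: rp; exists q.
  have muD : mu (E `\` iota @` CF_cyl m B) = (c%:E - mu (iota @` CF_cyl m B))%E.
    rewrite -muE -{2}(setIidr IE); exact: measureD.
  rewrite muD mu_iota_cyl// -EFinB lee_fin.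
  have h (a s t : R) : 0 < s -> 0 < t -> a / t * (r / (s / t)) = r * (a / s).
    by move=> s0 t0; field; rewrite !gt_eqF.
  by rewrite cE h.
have : (mu (E `\` range iota) <= (c - c * (r / r))%:E)%E.
  have lim : (fun m => c - c * (r / (prodS m / prodT (k m)))) @ \oo --> c - c * (r / r).
    apply: cvgB; first exact: cvg_cst.
    apply: cvgM; first exact: cvg_cst.
    apply: cvgM; first exact: cvg_cst.
    by apply: cvgV; rewrite ?gt_eqF.
  have limE : (fun m => (c - c * (r / (prodS m / prodT (k m))))%:E) @ \oo -->
      (c - c * (r / r))%:E.
    by apply: cvg_EFin lim; near=> m.
  apply: (cvge_to_ge limE).
  near=> m; apply: le; near: m; exact: nbhs_infty_ge.
by rewrite divff ?gt_eqF// mulr1 subrr measure_le0 => /eqP.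
Unshelve. all: by end_near. Qed.

End ConullImage.

(** * Transfer of measure, action and rank one to the telescoped system *)

Section Transfer.
Variables (R : realType) (G : groupType) (T S : CFseq G) (k : nat -> nat).
Hypothesis tel : telescopes T S k.
Hypothesis cG : countable [set: G].
Hypothesis Stot : forall g (q : CF_space S), exists q', CF_act g q q'.
Local Notation X := (CF_space T).
Local Notation Y := (CF_space S).
Local Notation iota := (iota_tel tel).
Local Notation phi := (tel_back tel).

Let prodS m : R := (\prod_(1 <= i < m.+1) #|` CF_C S i|)%:R.

Variable r : R.
Variable mu : {measure set (CF_borel T) -> \bar R}.
Hypothesis mu_iota : (forall n A, (A `<=` CF_F S n)%fset ->
    mu (iota @` CF_cyl n A) = (r * (#|` A|%:R / prodS n))%:E) /\
  mu (~` range iota) = 0%E.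

Lemma measurable_preimage_back (B : set (CF_borel S)) : measurable B ->
  measurable (phi @^-1` B : set (CF_borel T)).
Proof.
move=> mB; have := measurable_tel_back tel cG (@measurableT _ _) mB.
by rewrite setTI.
Qed.

Lemma measurable_preimage_iota (W : set (CF_borel T)) : measurable W ->
  measurable (iota @^-1` W : set (CF_borel S)).
Proof.
move=> mW; have := measurable_iota tel (@measurableT _ _) mW.
by rewrite setTI.
Qed.

Lemma mu_setI_range (W : set (CF_borel T)) : measurable W ->
  mu (W `&` range iota) = mu W.
Proof.
move=> mW; have mR : measurable (range iota : set (CF_borel T)).
  exact: measurable_range_iota.
have W0 : mu (W `\` range iota) = 0%E.
  apply: (subset_measure0 _ _ _ mu_iota.2).
  - exact: measurableD.
  - exact: measurableC.
  - by move=> p [].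
have -> : mu W = (mu (W `\` range iota) + mu (W `&` range iota))%E.
  exact: measureDI.
by rewrite W0 add0e.
Qed.

(** Both sets have the same trace on the image of the embedding, which is conull. *)
Lemma mu_preimage_back (W : set (CF_borel T)) : measurable W ->
  mu (phi @^-1` (iota @^-1` W)) = mu W.
Proof.
move=> mW; have mV := measurable_preimage_back (measurable_preimage_iota mW).
rewrite -(mu_setI_range mV) -(mu_setI_range mW); congr (mu _).
apply/seteqP; split=> p [Vp rp]; split=> //; move: Vp; rewrite /= tel_backK//.
Qed.

Lemma mu_preimage_cyl n A : (A `<=` CF_F S n)%fset ->
  mu (phi @^-1` CF_cyl n A) = (r * (#|` A|%:R / prodS n))%:E.
Proof.
move=> AF; rewrite -(mu_iota.1 _ _ AF).
have mI := measurable_iota_cyl tel AF.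
rewrite -(mu_preimage_back mI); congr (mu (phi @^-1` _)).
apply/seteqP; split=> q /=; first by exists q.
by move=> [q' Aq' /iota_inj <-].
Qed.

Variable nu : {measure set (CF_borel S) -> \bar R}.
Hypothesis nu_scaled : 0 < r /\ forall A, nu A = (r^-1%:E * mu (phi @^-1` A))%E.

Lemma nu_preimage_iota (W : set (CF_borel T)) : measurable W ->
  nu (iota @^-1` W) = (r^-1%:E * mu W)%E.
Proof. by move=> mW; rewrite nu_scaled.2 (mu_preimage_back mW); reflexivity. Qed.

Lemma nu_cyl n A : (A `<=` CF_F S n)%fset ->
  nu (CF_cyl n A) = (#|` A|%:R / prodS n)%:E.
Proof. by move=> AF; rewrite nu_scaled.2 mu_preimage_cyl// -EFinM mulKf ?gt_eqF ?nu_scaled.1. Qed.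

Lemma nu_radon : CF_radon mu -> CF_radon nu.
Proof.
move=> mu_radon; split=> [K cK|A mA].
  have [n Kn] := compact_sub_cyl cK.
  apply: (@le_lt_trans _ _ (nu (CF_cyl n (CF_F S n)))); last by rewrite nu_cyl ?ltry.
  apply: le_measure => //; rewrite inE; last exact: measurable_cyl.
  exact: compact_measurable.
apply/eqP; rewrite eq_le; apply/andP; split; last first.
  apply: ge_ereal_sup => _ [K [cK KA] <-].
  by apply: le_measure => //; rewrite inE//; exact: compact_measurable.
set s := ereal_sup _.
have mI : measurable (phi @^-1` A `&` range iota : set (CF_borel T)).
  apply: measurableI; first exact: measurable_preimage_back.
  exact: measurable_range_iota.
rewrite nu_scaled.2 -mu_setI_range; last exact: measurable_preimage_back.
rewrite (lee_pdivrMl _ _ nu_scaled.1) (mu_radon.2 _ mI); apply: ge_ereal_sup => _ [K [cK KA] <-].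
have mK := compact_measurable cK.
(* The preimage of a compact [K] may fail to be compact, so [K] is exhausted by its parts in the
   images of $X'_n$. The preimage of each part is closed in the compact set $X'_n$. *)
pose L n := K `&` iota @` CF_cyl n (CF_F S n) : set (CF_borel T).
have mL n : measurable (L n).
  exact: measurableI mK (measurable_iota_cyl tel (fsubset_refl _)).
have ndL : {homo L : i j / (i <= j)%N >-> preorder.Order.le i j}.
  move=> i j ij; apply/subsetPset => p [Kp [q /cylP [f fF qf] qp]]; split=> //.
  exists q => //; have [c _ qc] := head_up ij qf.
  by apply/cylP; exists (f * c)%g => //; exact: head_F qc.
have UL : \bigcup_n L n = K.
  rewrite -setI_bigcupr -(range_iota tel); apply/setIidPl => p Kp.
  by have [] := KA p Kp.
have cvgL : (mu \o L) @ \oo --> mu K.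
  rewrite -UL; exact: nondecreasing_cvg_mu mL (bigcupT_measurable _ mL) ndL.
apply: (cvge_to_le cvgL).
near=> n => /=.
pose M := iota @^-1` K `&` CF_cyl n (CF_F S n) : set Y.
have cM : compact M.
  apply: (subclosed_compact _ (compact_cyl (fsubset_refl (CF_F S n)))).
    apply: closedI.
      apply: closed_comp => [q _|]; first exact: iota_continuous.
      by apply: compact_closed cK; exact: hausdorff_CF_space.
    by apply: compact_closed; [exact: hausdorff_CF_space|exact: compact_cyl].
  by move=> q [].
have ML : M = iota @^-1` (L n).
  apply/seteqP; split=> q [Kq]; first by move=> nq; split=> //; exists q.
  by move=> [q' nq' /iota_inj e]; split=> //; rewrite -e.
have MA : M `<=` A.
  by move=> q [/KA [Aq _] _]; move: Aq; rewrite /= iotaK.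
have Ms : (nu M <= s)%E by apply: ereal_sup_ubound; exists M.
have nuM : nu M = (r^-1%:E * mu (L n))%E by rewrite ML; exact: nu_preimage_iota (mL n).
rewrite nuM (lee_pdivrMl _ _ nu_scaled.1) in Ms; exact: Ms.
Unshelve. all: by end_near. Qed.

(** The image of the embedding is invariant: [Stot] for the inverse of [g] gives a preimage inside
    it, and by [act_uniq] there is no other. *)
Lemma preimage_graph_image g (B : set X) :
  iota @^-1` (graph_image (CF_act g) B) = graph_image (CF_act g) (iota @^-1` B).
Proof.
apply/seteqP; split=> q /=.
  move=> [p Bp pq]; have [q' qq'] := Stot g^-1%g q.
  have e : iota q' = p by apply: act_uniq (act_inv pq); apply/iota_act.
  by exists q'; [rewrite /= e|exact: act_invP].
by move=> [q' Bq' q'q]; exists (iota q') => //; apply/iota_act.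
Qed.

Lemma tel_ae_isomorphic : ae_isomorphic mu nu (@CF_act G T) (@CF_act G S).
Proof.
have mCR : measurable (~` range iota : set (CF_borel T)).
  by apply: measurableC; exact: measurable_range_iota.
exists phi; split.
- exact: measurable_tel_back.
- exists (~` range iota), set0; split.
  + exact: mCR.
  + exact: mu_iota.2.
  + exact: measurable0.
  + exact: measure0.
  rewrite setCK setC0; split; first exact: (fun _ _ => I).
    move=> p p' /set_mem [q _ <-] /set_mem [q' _ <-].
    by rewrite !iotaK => e; rewrite e.
  by move=> q _; exists (iota q); [exists q|exact: iotaK].
- move=> g; exists (~` range iota).
  split; [exact: mCR|exact: mu_iota.2|].
  apply: subsetC => _ [q _ <-] /=; have [q' qq'] := Stot g q.
  by exists (iota q'); [apply/iota_act|rewrite !iotaK].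
- exists r; first exact: nu_scaled.1.
  move=> A mA.
  by rewrite nu_scaled.2 muleA -EFinM divff ?gt_eqF ?nu_scaled.1// mul1e.
Qed.

Lemma tel_rank_one (e : int -> G) : rank_one mu (fun a => @CF_act G T (e a)) ->
  rank_one nu (fun a => @CF_act G S (e a)).
Proof.
move=> [B [h [mB dB apx]]]; exists (fun n => iota @^-1` (B n)), h; split.
- move=> n; have [mBn Bnoo] := mB n; split; first exact: measurable_preimage_iota.
  by rewrite nu_preimage_iota// lte_mul_pinfty// lee_fin invr_ge0 ltW ?nu_scaled.1.
- move=> n i j ih jh; rewrite -!preimage_graph_image => -[q [qi qj]].
  by apply: (dB n i j) => //; exists (iota q).
move=> A mA Aoo.
have mA' := measurable_preimage_back mA.
have A'oo : (mu (phi @^-1` A) < +oo)%E.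
  have -> : mu (phi @^-1` A) = (r%:E * nu A)%E.
    by rewrite nu_scaled.2 muleA -EFinM divff ?gt_eqF ?nu_scaled.1// mul1e.
  by rewrite lte_mul_pinfty// lee_fin ltW ?nu_scaled.1.
have := apx _ mA' A'oo.
(* Multiplying by $1/r$ turns each $\mu$-error into the $\nu$-error of the pulled-back tower with
   the same index set. *)
move/(cvgeZl (y := r^-1%:E)) => /(_ isT); rewrite mule0.
apply: cvg_trans; apply: near_eq_cvg; near=> n.
have rV : 0 < r^-1 by rewrite invr_gt0 nu_scaled.1.
rewrite -(ereal_inf_pZl _ rV) image_comp; congr (ereal_inf _).
apply: eq_imagel => I IH /=.
rewrite -nu_preimage_iota; last first.
  have mU : measurable (\bigcup_(i in I)
      graph_image (CF_act (e i%:Z)) (B n) : set (CF_borel T)).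
    by apply: bigcup_measurable => i _; apply: measurable_graph_image; case: (mB n).
  by apply: measurableU; apply: measurableD.
have preY (P Q : set X) : iota @^-1` (P `+` Q) = (iota @^-1` P) `+` (iota @^-1` Q).
  by [].
have preA : iota @^-1` (phi @^-1` A) = A.
  by apply/seteqP; split=> q /=; rewrite iotaK.
have preU : iota @^-1` (\bigcup_(i in I) graph_image (CF_act (e i%:Z)) (B n)) =
    \bigcup_(i in I) graph_image (CF_act (e i%:Z)) (iota @^-1` B n).
  by rewrite preimage_bigcup; apply: eq_bigcupr => i _; exact: preimage_graph_image.
by rewrite preY preA preU.
Unshelve. all: by end_near. Qed.

End Transfer.

(** * Counting the exceptional elements of $C_{n+1}\cdots C_m$ *)

Lemma card_fset_cover (I K : choiceType) (s : seq I) (B : I -> {fset K})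
    (A : {fset K}) (c p : nat) :
  (forall x, x \in A -> exists2 i, i \in s & x \in B i) ->
  (forall i, i \in s -> (c * #|` B i| <= p)%N) -> (c * #|` A| <= size s * p)%N.
Proof.
elim: s A => [|i s IH] A AB Bp.
  have -> : A = fset0; last by rewrite cardfs0 muln0.
  by apply/fsetP => x; rewrite inE; apply/negP => /AB [].
rewrite -(cardfsID (B i) A) mulnDr mulSn leq_add//.
  apply: leq_trans (Bp i (mem_head _ _)); rewrite leq_mul2l.
  by rewrite fsubset_leq_card ?orbT// fsubsetIr.
apply: IH => [x|j js]; last by apply: Bp; rewrite inE js orbT.
rewrite inE => /andP [xBi /AB [j]]; rewrite inE => /predU1P [->|js xBj].
  by rewrite (negbTE xBi).
by exists j.
Qed.

Lemma eventually_all_mem (I : eqType) (s : seq I) (Q : I -> nat -> Prop) :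
  (forall i, i \in s -> exists N, forall m, (N <= m)%N -> Q i m) ->
  exists N, forall m i, (N <= m)%N -> i \in s -> Q i m.
Proof.
elim: s => [_|i s IH h]; first by exists 0%N.
have [N hN] := IH (fun j js => h j (mem_behead (s := i :: s) js)).
have [M hM] := h i (mem_head _ _).
exists (maxn N M) => m j; rewrite geq_max => /andP [Nm Mm].
by rewrite inE => /predU1P [->|]; [exact: hM|exact: hN].
Qed.

Section Thinning.
Variables (G : groupType) (T : CFseq G).
Local Notation F := (CF_F T).
Local Notation P := (CF_prodC T).
Implicit Types (K : {fset G}) (n m : nat).

Definition thin K n m : {fset G} :=
  [fset c in P n m | all (fun g => all (fun f => (g * (f * c))%g \in F m) (F n)) K]%fset.

Lemma thinP K n m c : c \in thin K n m <->
  c \in P n m /\ forall g f, g \in K -> f \in F n -> (g * (f * c))%g \in F m.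
Proof.
rewrite !inE /=; split=> [/andP [cP /allP h]|[cP h]].
  by split=> // g f gK fF; have /allP := h g gK; exact.
by rewrite cP; apply/allP => g gK; apply/allP => f fF; exact: h.
Qed.

(** Each exceptional [c] yields an element $g\,w(c)\,c$ outside $F_m$ with $w(c)\in F_n$. By unique
    factorization these are distinct, so at least as many elements of the translate escape. *)
Lemma card_escape g n m : (n <= m)%N ->
  (#|` fset_lmul g (fset_mul (F n) (P n m)) `&` F m| +
   #|` [fset c in P n m | has (fun f => (g * (f * c))%g \notin F m) (F n)]|
     <= #|` F n| * #|` P n m|)%fset%N.
Proof.
move=> nm; set E := fset_lmul _ _.
have -> : (#|` F n| * #|` P n m| = #|` E|)%N.
  rewrite -card_mul_prodC//; apply/esym; apply: card_in_imfset => x y _ _.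
  exact: mulgI.
rewrite -(cardfsID (F m) E) leq_add2l.
set B := [fset c in P n m | _]%fset.
have /choice [w wP] : forall c, exists f, c \in B ->
    f \in F n /\ (g * (f * c))%g \notin F m.
  move=> c; have [|cB] := boolP (c \in B); last by exists 1%g.
  by rewrite !inE => /andP [_ /hasP [f fF gfc]]; exists f.
have BP c : c \in B -> c \in P n m by rewrite !inE => /andP [].
have -> : #|` B| = #|` [fset (g * (w c * c))%g | c in B]%fset|.
  apply/esym; apply: card_in_imfset => c c' cB c'B /= /mulgI.
  have [wF _] := wP c cB; have [w'F _] := wP c' c'B.
  by move=> /(F_prodC_inj nm wF w'F (BP _ cB) (BP _ c'B)) [].
apply: fsubset_leq_card; apply/fsubsetP => _ /imfsetP [c /= cB ->].
have [wF wN] := wP c cB; rewrite inE wN /=.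
by apply: in_imfset; exact: mem_fset_mul (BP _ cB).
Qed.

Lemma card_prodC_gt1 n m : (n < m)%N -> (1 < #|` P n m|)%N.
Proof.
case: m => // m; rewrite ltnS => nm.
rewrite card_prodC ?leqW// big_nat_recr//=.
by apply: leq_trans (CF_C_gt1 T m) _; rewrite leq_pmull// prod_card_C_gt0.
Qed.

(** Asymptotic invariance bounds the exceptional elements for each [g], and a union bound over [K]
    follows. At $n=0$ it says nothing, hence the alternative that [K] is empty. *)
Lemma thin_large (R : realType) K n a : CF_asymp_invariant T R ->
  (0 < n)%N \/ K = fset0 ->
  exists m, (n < m)%N /\ (a * #|` P n m `\` thin K n m| <= #|` P n m|)%fset%N.
Proof.
move=> asym nK.
pose B g m := [fset c in P n m | has (fun f => (g * (f * c))%g \notin F m) (F n)]%fset.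
have [N hN] : exists N, forall m g, (N <= m)%N -> g \in K ->
    (n < m)%N -> (a * #|` K| * #|` B g m| <= #|` P n m|)%N.
  apply: (@eventually_all_mem _ K (fun g m => (n < m)%N ->
    (a * #|` K| * #|` B g m| <= #|` P n m|)%N)) => g gK.
  have n0 : (0 < n)%N by case: nK gK => // ->.
  have Fgt0 : (0 < #|` F n|)%N.
    by have [f fF] := F_neq0 T n; rewrite cardfs_gt0; apply/fset0Pn; exists f.
  (* The factor [#|F n|] cancels the one in [card_escape]; [#|K|] anticipates the union bound, and
     the successor keeps the denominator nonzero. *)
  pose eps : R := ((a * #|` K|).+1 * #|` F n|)%:R^-1.
  have eps0 : 0 < eps by rewrite invr_gt0 ltr0n muln_gt0.
  have lt1 : 1 - eps < 1 by rewrite ltrBlDr ltrDl.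
  have [M _ hM] := cvgr_ge _ (asym g n n0) _ lt1; exists M => m Mm nm.
  have := hM m Mm; rewrite /= -(card_prodC T (ltnW nm)).
  have := card_escape g (ltnW nm).
  rewrite -/(B g m); set e := #|` fset_lmul _ _ `&` _|%fset.
  move: (card_prodC_gt1 nm) => /ltnW Pgt0 eB.
  rewrite ler_pdivlMr ?ltr0n ?muln_gt0 ?Fgt0// mulrBl mul1r => ePe.
  have : (#|` B g m|%:R <= eps * (#|` F n| * #|` P n m|)%:R :> R).
    move: eB; rewrite -(ler_nat R) natrD => eB.
    rewrite -(lerD2l e%:R); apply: le_trans eB _.
    by rewrite -lerBlDr.
  rewrite /eps ler_pdivlMl ?ltr0n ?muln_gt0// -natrM ler_nat.
  rewrite mulnAC mulnC leq_pmul2l// => le; apply: leq_trans le.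
  by rewrite leq_mul2r leqnSn orbT.
pose m := maxn N n.+1; have Nm : (N <= m)%N by exact: leq_maxl.
have nm : (n < m)%N by exact: leq_maxr.
exists m; split=> //.
have [K0|K0] := eqVneq K fset0.
  rewrite (_ : _ `\` _ = fset0)%fset; first by rewrite cardfs0 muln0.
  apply/fsetP => c; rewrite !inE; apply/negbTE; rewrite negb_and negbK.
  by case: (boolP (c \in P n m)); rewrite ?orbT// => _; rewrite K0.
have Kgt0 : (0 < #|` K|)%N by rewrite cardfs_gt0.
rewrite -(leq_pmul2l Kgt0) mulnA (mulnC #|` K|).
apply: (card_fset_cover (B := fun g => B g m)) => [c|g gK]; last exact: hN.
rewrite inE => /andP [cT cP].
have : ~~ all (fun g => all (fun f => (g * (f * c))%g \in F m) (F n)) K.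
  by apply: contra cT => h; rewrite !inE cP.
move=> /allPn [g gK /allPn [f fF gfc]]; exists g => //.
by rewrite !inE cP; apply/hasP; exists f.
Qed.

End Thinning.

(** * Convergence of the density product to a positive limit *)

Lemma prod_cvg_gt0 (R : realType) (u v : nat -> nat) :
  (forall j, (0 < v j)%N) -> (forall j, (u j <= v j)%N) ->
  (forall j, (2 ^ j.+2 * (v j - u j) <= v j)%N) ->
  exists2 r : R, 0 < r &
    (fun m => \prod_(i < m) ((u i)%:R / (v i)%:R)) @ \oo --> r.
Proof.
move=> v0 uv uv2; pose a m : R := \prod_(i < m) ((u i)%:R / (v i)%:R).
have vR j : 0 < (v j)%:R :> R by rewrite ltr0n.
have aS m : a m.+1 = a m * ((u m)%:R / (v m)%:R) by rewrite /a big_ord_recr.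
have a_ge0 m : 0 <= a m by apply: prodr_ge0 => i _; rewrite divr_ge0.
have a_le m : a m.+1 <= a m.
  by rewrite aS ler_piMr// ler_pdivrMr// mul1r ler_nat.
have rho m : 1 - (2 ^+ m.+2)^-1 <= (u m)%:R / (v m)%:R :> R.
  rewrite ler_pdivlMr// mulrBl mul1r lerBlDr -lerBlDl -natrB//.
  by rewrite ler_pdivlMl ?exprn_gt0// -natrX -natrM ler_nat.
have a1 m : a m <= 1.
  elim: m => [|m IH]; first by rewrite /a big_ord0.
  exact: le_trans (a_le m) IH.
(* As [a m <= 1], one step loses at most $2^{-(m+2)}$, exactly the drop of this lower bound;
   equality holds at $m=0$. *)
have a_lb m : 2^-1 + (2 ^+ m.+1)^-1 <= a m.
  elim: m => [|m IH]; first by rewrite /a big_ord0 expr1; lra.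
  have p : 0 < (2 ^+ m.+2)^-1 :> R by rewrite invr_gt0 exprn_gt0.
  have e : (2 ^+ m.+1)^-1 = 2 * (2 ^+ m.+2)^-1 :> R.
    by rewrite [2 ^+ m.+2]exprS invfM mulVKf.
  have h := ler_wpM2l (a_ge0 m) (rho m); have := a1 m.
  rewrite aS; rewrite e in IH; nra.
have a_ge m : 2^-1 <= a m.
  by apply: le_trans (a_lb m); rewrite lerDl invr_ge0 exprn_ge0.
have cvga : cvgn a.
  apply: nonincreasing_is_cvgn; first exact/nonincreasing_seqP.
  by exists 2^-1 => _ [m _ <-].
exists (limn a) => //; apply: (@lt_le_trans _ _ 2^-1); first by rewrite invr_gt0.
by apply: limr_ge => //; near=> m.
Unshelve. all: by end_near. Qed.

(** * Recursive choice of the levels and of the thinned sets *)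

Section Construction.
Variables (R : realType) (G : groupType) (T : CFseq G).
Hypothesis cG : countable [set: G].
Hypothesis asym : CF_asymp_invariant T R.

Lemma exists_thinning : exists (S : CFseq G) (k : nat -> nat) (r : R),
  [/\ telescopes T S k,
      forall g, exists N, forall n f c, (N <= n)%N -> f \in CF_F S n ->
        c \in CF_C S n.+1 -> (g * (f * c))%g \in CF_F S n.+1,
      0 < r
    & (fun m => (\prod_(1 <= i < m.+1) #|` CF_C S i|)%:R /
        (\prod_(1 <= i < (k m).+1) #|` CF_C T i|)%:R) @ \oo --> r].
Proof.
have /countable_injP [code codeI] := cG.
have /choice [enc encP] : forall i, exists g, forall g', code g' = i -> g = g'.
  move=> i; have [[g gi]|h] := pselect (exists g, code g = i).
    by exists g => g' g'i; apply: codeI; rewrite ?inE// gi.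
  by exists 1%g => g' g'i; case: h; exists g'.
(* An increasing exhaustion of $G$ by finite sets. It starts with the empty set because level
   [k 0 = 0] is not covered by the invariance hypothesis. *)
pose K j := [fset enc i | i in iota 0 j]%fset.
have KP g j : (code g < j)%N -> g \in K j.
  move=> gj; apply/imfsetP; exists (code g); first by rewrite /= mem_iota.
  exact/esym/encP.
have K0 : K 0%N = fset0 by apply/fsetP => g; rewrite inE; apply/negP => /imfsetP [].
(* The next level is chosen for every pair of stage and current level, so that [k] can then be
   defined by recursion. *)
have /choice [nx nxP] : forall jn : nat * nat, exists m, (jn.2 < m)%N /\
    ((0 < jn.2)%N \/ jn.1 = 0%N ->
     2 ^ jn.1.+2 * #|` CF_prodC T jn.2 m `\` thin T (K jn.1) jn.2 m| <=
     #|` CF_prodC T jn.2 m|)%fset%N.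
  move=> [j n] /=; have [h|h] := pselect ((0 < n)%N \/ K j = fset0).
    by have [m [nm hm]] := thin_large (2 ^ j.+2) asym h; exists m.
  exists n.+1; split=> // -[n0|j0]; case: h; first by left.
  by right; rewrite j0.
pose k := fix k j := if j is i.+1 then nx (i, k i) else 0%N.
have kS j : (k j < k j.+1)%N by case: (nxP (j, k j)).
have klarge j : (2 ^ j.+2 *
    #|` CF_prodC T (k j) (k j.+1) `\` thin T (K j) (k j) (k j.+1)| <=
    #|` CF_prodC T (k j) (k j.+1)|)%fset%N.
  have [_ /=] := nxP (j, k j); apply.
  by case: j => [|j]; [right|left; exact: leq_ltn_trans (kS j)].
pose F j := CF_F T (k j).
pose C j := if j is i.+1 then thin T (K i) (k i) (k i.+1) else fset0.
have CP j c : c \in C j.+1 -> c \in CF_prodC T (k j) (k j.+1) by case/thinP.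
have CsubP j : (C j.+1 `<=` CF_prodC T (k j) (k j.+1))%fset.
  by apply/fsubsetP => c; exact: CP.
have cardC j : (#|` CF_prodC T (k j) (k j.+1) `\` C j.+1| =
    #|` CF_prodC T (k j) (k j.+1)| - #|` C j.+1|)%fset%N by exact: cardfsDS.
(* At most a quarter of at least two elements is removed, so at least two remain. *)
have C_gt1 j : (1 < #|` C j.+1|)%N.
  have := klarge j; rewrite -/(C j.+1) cardC !expnS.
  have := card_prodC_gt1 T (kS j); have := fsubset_leq_card (CsubP j).
  have : (0 < 2 ^ j)%N by rewrite expn_gt0.
  set x := (2 ^ j)%N; set p := #|` CF_prodC _ _ _|; set c := #|` C _|.
  by nia.
have FC_sub j : (fset_mul (F j) (C j.+1) `<=` F j.+1)%fset.
  apply/fsubsetP => _ /fset_mulP [f [c [fF cC ->]]].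
  exact: F_prodC (ltnW (kS j)) fF (CP _ _ cC).
have FC_disj j c c' : c \in C j.+1 -> c' \in C j.+1 -> c != c' ->
    [disjoint fset_rmul (F j) c & fset_rmul (F j) c']%fset.
  move=> cC c'C /eqP cc'; apply/fdisjointP => _ /imfsetP [f /= fF ->].
  apply/negP => /imfsetP [f' /= f'F e]; apply: cc'.
  by have [] := F_prodC_inj (ltnW (kS j)) fF f'F (CP _ _ cC) (CP _ _ c'C) e.
pose S := MkCFseq (CF_F0 T : F 0%N = _) C_gt1 FC_sub FC_disj.
have P_gt0 j : (0 < #|` CF_prodC T (k j) (k j.+1)|)%N.
  exact: ltnW (card_prodC_gt1 T (kS j)).
have C_le j := fsubset_leq_card (CsubP j).
have C_large j : (2 ^ j.+2 * (#|` CF_prodC T (k j) (k j.+1)| - #|` C j.+1|) <=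
    #|` CF_prodC T (k j) (k j.+1)|)%N by rewrite -cardC; exact: klarge.
have [r r0 rcvg] := prod_cvg_gt0 R P_gt0 C_le C_large.
exists S, k, r; split=> //.
  move=> g; exists (code g).+1 => n f c gn fF /thinP [_]; apply=> //.
  exact: KP.
suff E m : (\prod_(1 <= i < m.+1) #|` CF_C S i|)%:R /
    (\prod_(1 <= i < (k m).+1) #|` CF_C T i|)%:R =
    \prod_(i < m) (#|` C i.+1|%:R / #|` CF_prodC T (k i) (k i.+1)|%:R) :> R.
  by under eq_fun do rewrite E.
elim: m => [|m IH]; first by rewrite big_ord0 !big_geq// divr1.
have kkm : ((k m).+1 <= (k m.+1).+1)%N by rewrite ltnS; exact: ltnW (kS m).
rewrite big_ord_recr/= -IH big_nat_recr//=.
rewrite (@big_cat_nat _ _ _ (k m).+1 1%N _ xpredT (fun i => #|` CF_C T i|) isT kkm)/=.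
by rewrite -(card_prodC T (ltnW (kS m))) !natrM invfM mulrACA.
Qed.

End Construction.

(** * Eventual invariance and assembly of the isomorphism *)

Lemma eventually_invariant_of (G : groupType) (S : CFseq G) :
  (forall g, exists N, forall n f c, (N <= n)%N -> f \in CF_F S n ->
     c \in CF_C S n.+1 -> (g * (f * c))%g \in CF_F S n.+1) ->
  CF_eventually_invariant S.
Proof.
(* All factors but the last are absorbed into $F'_M$; since $M\ge N$, the last one keeps the
   translate by [g] inside $F'_{M+1}$. *)
move=> h g n _; have [N hN] := h g; pose M := maxn n N.
have nM : (n <= M)%N by exact: leq_maxl.
exists M.+1; split=> //; apply/fsubsetP => _ /imfsetP [x /= + ->].
move=> /fset_mulP [f [c [fF + ->]]]; rewrite prodC_recr//.
move=> /fset_mulP [a [b [aP bC ->]]]; rewrite (mulgA f).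
by apply: hN => //; [exact: leq_maxr|exact: F_prodC aP].
Qed.

Theorem theorem1p8 (R : realType) (G : groupType)
  (Gcountable : countable [set: G]) (Ginfinite : infinite_set [set: G])
  (T : CFseq G) (Tasymp : CF_asymp_invariant T R) :
  exists S : CFseq G,
    [/\ CF_eventually_invariant S,
        exists k : nat -> nat, {homo k : i j / (i < j)%N} /\
          forall n, CF_F S n = CF_F T (k n)
      & forall mu : {measure set (CF_borel T) -> \bar R}, CF_measure mu ->
        exists nu : {measure set (CF_borel S) -> \bar R},
          [/\ CF_measure nu,
              ae_isomorphic mu nu (@CF_act G T) (@CF_act G S)
            & forall e : int -> G, bijective e ->
                {morph e : a b / a + b >-> (a * b)%g} ->
                rank_one mu (fun a => @CF_act G T (e a)) ->
                rank_one nu (fun a => @CF_act G S (e a))]].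
Proof.
have [S [k [r [tel hS r0 rcvg]]]] := exists_thinning Gcountable Tasymp.
exists S; split; first exact: eventually_invariant_of.
  exists k; split; last exact: tel_F tel.
  by apply: homo_ltn ltn_trans _ => j; exact: tel_lt tel j.
move=> mu [mu_radon mu_cyl].
have muI := conj (mu_iota_cyl tel rcvg mu_cyl) (mu_range_iota tel r0 rcvg mu_cyl).
have rV : 0 <= r^-1 by rewrite invr_ge0 ltW.
(* The push-forward gives cylinders [r] times their required mass, whence the factor $1/r$. *)
have [nu nuE] := scaled_pushforward mu (measurable_tel_back tel Gcountable) rV.
have nuI := conj r0 nuE; have Stot := act_total hS.
exists nu; split.
- split; first exact (nu_radon Gcountable muI nuI mu_radon).
  exact (nu_cyl Gcountable muI nuI).
- exact (tel_ae_isomorphic Gcountable Stot muI nuI).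
- move=> e _ _; exact (tel_rank_one Gcountable Stot muI nuI (e := e)).
Qed.
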